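(* Let $\alpha>-1$. The operator $H_\alpha$ generates a positivity preserving semigroup $e^{-tH_\alpha}$, $t>0$. Moreover, for $\alpha=0$, the corresponding semigroup $e^{-tH_0}$, $t>0$, is Markovian.
   Context: For $\alpha>-1$ and a complex sequence $u=(u_n)_{n\ge 0}$ (with $u_{-1}:=0$) put $$(\tau_\alpha u)_n=-\sqrt{n(n+\alpha)}\,u_{n-1}+(2n+1+\alpha)u_n-\sqrt{(n+1)(n+1+\alpha)}\,u_{n+1},\quad n\ge 0.$$ The discrete Laguerre operator $H_\alpha$ in $\ell^2(\mathbb{Z}_{\ge 0})$ is $H_\alpha u=\tau_\alpha u$ with domain $\{u\in\ell^2(\mathbb{Z}_{\ge0}) : \tau_\alpha u\in\ell^2(\mathbb{Z}_{\ge0})\}$; it is self-adjoint and nonnegative. A semigroup on $\ell^2(\mathbb{Z}_{\ge0})$ is positivity preserving if it maps (entrywise) nonnegative sequences to nonnegative sequences; it is Markovian if it is positivity preserving and $\ell^\infty$-contractive, i.e. $\|e^{-tH}u\|_{\ell^\infty}\le\|u\|_{\ell^\infty}$ for all $u\in\ell^2\cap\ell^\infty$ and $t>0$. *)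

(* Defs.v *)
From Stdlib Require Import Reals.
From Coquelicot Require Import Coquelicot.

Open Scope R_scope.

Definition cseq := nat -> C.

(* The entrywise operations are left unbundled: operators below act on all of
   cseq, and only their values on square-summable sequences are meaningful. *)
Definition seq_plus (u v : cseq) : cseq := fun n => Cplus (u n) (v n).
Definition seq_opp (u : cseq) : cseq := fun n => Copp (u n).
Definition seq_minus (u v : cseq) : cseq := seq_plus u (seq_opp v).
Definition seq_scal (c : C) (u : cseq) : cseq := fun n => Cmult c (u n).

Definition in_l2 (u : cseq) : Prop := ex_series (fun n => Cmod (u n) ^ 2).

(* Only meaningful when in_l2 u holds. *)
Definition l2_norm (u : cseq) : R := sqrt (Series (fun n => Cmod (u n) ^ 2)).

Definition in_linf (u : cseq) : Prop := exists M : R, forall n, Cmod (u n) <= M.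

Definition linf_norm (u : cseq) : Rbar :=
  Sup_seq (fun n => Finite (Cmod (u n))).

(* Possibly unbounded operators in l^2; op_fun is irrelevant outside op_dom. *)
Record operator := Operator {
  op_dom : cseq -> Prop;
  op_fun : cseq -> cseq
}.

(* u_(n-1), with the convention u_(-1) = 0. *)
Definition prev (u : cseq) (n : nat) : C :=
  match n with
  | O => RtoC 0
  | S m => u m
  end.

Definition tau (alpha : R) (u : cseq) : cseq := fun n =>
  (- (RtoC (sqrt (INR n * (INR n + alpha))) * prev u n)
   + RtoC (2 * INR n + 1 + alpha) * u n
   - RtoC (sqrt ((INR n + 1) * (INR n + 1 + alpha))) * u (S n))%C.

Definition laguerre (alpha : R) : operator := {|
  op_dom := fun u => in_l2 u /\ in_l2 (tau alpha u);
  op_fun := tau alpha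
|}.

(* Strongly continuous one-parameter semigroups of bounded linear operators on
   l^2; the values T t for t < 0 are unconstrained. *)
Record C0_semigroup (T : R -> cseq -> cseq) : Prop := {
  sg_l2 : forall t u, 0 <= t -> in_l2 u -> in_l2 (T t u);
  sg_plus : forall t u v, 0 <= t -> in_l2 u -> in_l2 v ->
    T t (seq_plus u v) = seq_plus (T t u) (T t v);
  sg_scal : forall t c u, 0 <= t -> in_l2 u ->
    T t (seq_scal c u) = seq_scal c (T t u);
  sg_bounded : forall t, 0 <= t ->
    exists M : R, forall u, in_l2 u -> l2_norm (T t u) <= M * l2_norm u;
  sg_0 : forall u, in_l2 u -> T 0 u = u;
  sg_add : forall s t u, 0 <= s -> 0 <= t -> in_l2 u ->
    T (s + t) u = T s (T t u);
  sg_cont : forall u, in_l2 u ->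
    filterlim (fun t => l2_norm (seq_minus (T t u) u)) (at_right 0) (locally 0)
}.

(* (u, v) belongs to the graph of the infinitesimal generator of T:
   (T t u - u) / t tends to v in l^2 as t decreases to 0. *)
Definition generator_graph (T : R -> cseq -> cseq) (u v : cseq) : Prop :=
  in_l2 u /\ in_l2 v /\
  filterlim
    (fun t => l2_norm (seq_minus (seq_scal (RtoC (/ t)) (seq_minus (T t u) u)) v))
    (at_right 0) (locally 0).

(* T t = e^(-tH) for t >= 0: T is the strongly continuous semigroup whose
   infinitesimal generator, including its domain, is -H. *)
Definition generates (H : operator) (T : R -> cseq -> cseq) : Prop :=
  C0_semigroup T /\
  forall u v, generator_graph T u v <-> op_dom H u /\ v = seq_opp (op_fun H u).

Definition seq_nonneg (u : cseq) : Prop :=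
  forall n, Im (u n) = 0 /\ 0 <= Re (u n).

Definition positivity_preserving (T : R -> cseq -> cseq) : Prop :=
  forall t u, 0 < t -> in_l2 u -> seq_nonneg u -> seq_nonneg (T t u).

Definition linf_contractive (T : R -> cseq -> cseq) : Prop :=
  forall t u, 0 < t -> in_l2 u -> in_linf u ->
    Rbar_le (linf_norm (T t u)) (linf_norm u).

Definition markovian (T : R -> cseq -> cseq) : Prop :=
  positivity_preserving T /\ linf_contractive T.

(* Main.v *)
Require Import Defs.
From Stdlib Require Import Reals Lra Lia FunctionalExtensionality ClassicalEpsilon.
From Coquelicot Require Import Coquelicot.
Open Scope R_scope.

(** Conjugated by the square root of [wgt alpha k = (alpha + 1)_k / k!], the
    Laguerre matrix is minus the generator of the linear birth and death process
    with birth rates [n + 1 + alpha] and death rates [n], which is reversible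
    with respect to [wgt alpha]. Its transition densities [dens] are known in
    closed form and visibly nonnegative, so the kernel [heat] of the semigroup
    can be written down: it is symmetric, starts from the identity, and solves
    the backward equation ([is_derive_dens]), by an identity between finite
    sums. The transition probabilities sum to at most one ([dens_row_sum], from
    the negative binomial series), so Schur's test with weight
    [sqrt (wgt alpha n)] shows that [heat] defines symmetric contractions [flow]
    of l^2. For [alpha = 0] the weight is constant, and the row sums of [heat]
    itself are at most one; this gives the contraction of l^infinity, while
    positivity is immediate from the kernel for every [alpha].

    Two facts tie [flow] to the operator on its maximal domain. The off-diagonal
    entries grow linearly, hence the Wronskian at infinity vanishes and [tau] is
    symmetric on that domain ([tau_symmetric]). And on finitely supported
    sequences the flow is differentiable with a quadratic remainder, because
    [tau] maps such sequences to such sequences ([regular_trunc]). Moving [tau]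
    between the two sides of an inner product then gives the derivative of the
    flow on the whole maximal domain ([flow_increment]) and, conversely,
    identifies the generator entrywise ([flow_generator_graph]). The same duality
    shows that a solution of the heat equation in the maximal domain is given by
    the flow ([heat_equation_unique]), whence the semigroup law.

    An arbitrary semigroup [T] generated by the same operator preserves the
    domain and is differentiable on it from the right. Differentiability from
    the left needs a bound on [T t] uniform for small [t], which comes from a
    nested ball argument in the manner of Baire ([semigroup_locally_bounded]).
    Then [heat_equation_unique] applies to the orbits of [T], so [T] is [flow],
    and the properties of the kernel pass to it. *)


(** * The real Hilbert space of square-summable complex sequences *)

Lemma sum_succ (f : nat -> R) N : sum_n f (S N) = sum_n f N + f (S N).
Proof. exact (sum_Sn f N). Qed.

Lemma sum_le (f g : nat -> R) N :
  (forall n, (n <= N)%nat -> f n <= g n) -> sum_n f N <= sum_n g N.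
Proof.
  induction N as [|N IH]; intros H.
  - rewrite !sum_O. apply H; lia.
  - rewrite !sum_succ. assert (sum_n f N <= sum_n g N) by (apply IH; intros; apply H; lia).
    specialize (H (S N) (le_n _)). lra.
Qed.

Lemma sum_add (f g : nat -> R) N :
  sum_n (fun n => f n + g n) N = sum_n f N + sum_n g N.
Proof. exact (sum_n_plus f g N). Qed.

Lemma sum_scal (c : R) (f : nat -> R) N : sum_n (fun n => c * f n) N = c * sum_n f N.
Proof. exact (sum_n_mult_l (K := R_Ring) c f N). Qed.

Lemma sum_nonneg (f : nat -> R) N : (forall n, 0 <= f n) -> 0 <= sum_n f N.
Proof.
  intros H. induction N as [|N IH].
  - rewrite sum_O. apply H.
  - rewrite sum_succ. specialize (H (S N)). lra.
Qed.

Lemma sum_mono (f : nat -> R) N M :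
  (forall n, 0 <= f n) -> (N <= M)%nat -> sum_n f N <= sum_n f M.
Proof.
  intros H. induction 1 as [|M _ IH]; [lra|].
  rewrite sum_succ. specialize (H (S M)). lra.
Qed.

Lemma sum_eventually_zero (f : nat -> R) N M :
  (forall n, (N < n)%nat -> f n = 0) -> (N <= M)%nat -> sum_n f M = sum_n f N.
Proof.
  intros H. induction 1 as [|M HM IH]; [reflexivity|].
  rewrite sum_succ, IH, H by lia. apply Rplus_0_r.
Qed.

Lemma sum_ext_le (f g : nat -> R) N :
  (forall n, (n <= N)%nat -> f n = g n) -> sum_n f N = sum_n g N.
Proof. exact (sum_n_ext_loc f g N). Qed.

Lemma sum_last (f : nat -> R) N : (forall n, (n < N)%nat -> f n = 0) -> sum_n f N = f N.
Proof.
  intros H. destruct N as [|N]; [apply sum_O|].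
  rewrite sum_succ, (sum_ext_le _ (fun _ => 0)) by (intros; apply H; lia).
  rewrite sum_n_const, Rmult_0_r. apply Rplus_0_l.
Qed.

Lemma Series_eventually_zero (f : nat -> R) N :
  (forall n, (N < n)%nat -> f n = 0) -> is_series f (sum_n f N).
Proof.
  intros H. apply (is_lim_seq_ext_loc (fun _ => sum_n f N) (sum_n f) (sum_n f N)).
  - exists N. intros M HM. symmetry. now apply sum_eventually_zero.
  - apply is_lim_seq_const.
Qed.

Lemma sum_le_Series (f : nat -> R) N :
  (forall n, 0 <= f n) -> ex_series f -> sum_n f N <= Series f.
Proof.
  intros H [l Hl]. rewrite (is_series_unique _ _ Hl).
  apply (is_lim_seq_le_loc (fun _ => sum_n f N) (sum_n f) (sum_n f N) l).
  - exists N. intros M HM. now apply sum_mono.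
  - apply is_lim_seq_const.
  - exact Hl.
Qed.

Lemma Series_le_bound (f : nat -> R) B :
  ex_series f -> (forall N, sum_n f N <= B) -> Series f <= B.
Proof.
  intros [l Hl] H. rewrite (is_series_unique _ _ Hl).
  apply (is_lim_seq_le (sum_n f) (fun _ => B) l B).
  - exact H.
  - exact Hl.
  - apply is_lim_seq_const.
Qed.

Lemma ex_series_bounded (f : nat -> R) B :
  (forall n, 0 <= f n) -> (forall N, sum_n f N <= B) -> ex_series f.
Proof.
  intros H0 HB.
  destruct (ex_finite_lim_seq_incr (sum_n f) B) as [l Hl].
  - intros n. rewrite sum_succ. specialize (H0 (S n)). lra.
  - exact HB.
  - exists l. exact Hl.
Qed.

Lemma ex_series_dominated (f g : nat -> R) :
  (forall n, Rabs (f n) <= g n) -> ex_series g -> ex_series f.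
Proof. exact (@ex_series_le R_AbsRing R_CompleteNormedModule f g). Qed.

(** The real inner product on [C]; complex sequences are treated as a real
    Hilbert space, in which the real Laguerre matrix is symmetric. *)
Definition dot (z w : C) : R := Re z * Re w + Im z * Im w.

Lemma Cmod_sq z : Cmod z ^ 2 = dot z z.
Proof. rewrite Cmod2_alt. unfold dot. ring. Qed.

Lemma dot_sym z w : dot z w = dot w z.
Proof. unfold dot. ring. Qed.

Lemma dot_le z w : Rabs (dot z w) <= Cmod z * Cmod w.
Proof.
  apply Rsqr_incr_0_var.
  - rewrite <- Rsqr_abs. unfold Rsqr.
    replace (Cmod z * Cmod w * (Cmod z * Cmod w)) with (Cmod z ^ 2 * Cmod w ^ 2) by ring.
    rewrite !Cmod2_alt. unfold dot.
    assert (0 <= (Re z * Im w - Im z * Re w) ^ 2) by apply pow2_ge_0. nra.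
  - apply Rmult_le_pos; apply Cmod_ge_0.
Qed.

Lemma dot_plus_l z1 z2 w : dot (z1 + z2)%C w = dot z1 w + dot z2 w.
Proof. unfold dot, Re, Im, Cconj, Cplus, Cmult, RtoC; simpl; ring. Qed.

Lemma dot_real_l r z w : dot (RtoC r * z)%C w = r * dot z w.
Proof. unfold dot, Re, Im, Cconj, Cplus, Cmult, RtoC; simpl; ring. Qed.

Lemma dot_mult_l c z w : dot (c * z)%C w = dot z (Cconj c * w)%C.
Proof. unfold dot, Re, Im, Cconj, Cplus, Cmult, RtoC; simpl; ring. Qed.

Lemma dot_inj z w : (forall c, dot z c = dot w c) -> z = w.
Proof.
  intros H. apply injective_projections.
  - specialize (H (RtoC 1)). unfold dot in H. simpl in H. unfold Re, Im in H. lra.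
  - specialize (H Ci). unfold dot in H. simpl in H. unfold Re, Im in H. lra.
Qed.

Definition ip (u v : cseq) : R := Series (fun n => dot (u n) (v n)).

Definition zeroseq : cseq := fun _ => RtoC 0.

Ltac seq_eq :=
  apply functional_extensionality; intro;
  unfold seq_minus, seq_plus, seq_opp, seq_scal, zeroseq, Re, Im;
  apply injective_projections; simpl; ring.

Lemma ex_modmod u v : in_l2 u -> in_l2 v -> ex_series (fun n => Cmod (u n) * Cmod (v n)).
Proof.
  intros Hu Hv.
  apply (ex_series_dominated _ (fun n => Cmod (u n) ^ 2 + Cmod (v n) ^ 2)).
  - intros n. rewrite Rabs_pos_eq by (apply Rmult_le_pos; apply Cmod_ge_0).
    assert (0 <= (Cmod (u n) - Cmod (v n)) ^ 2) by apply pow2_ge_0.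
    assert (H1 := Cmod_ge_0 (u n)). assert (H2 := Cmod_ge_0 (v n)). nra.
  - now apply (ex_series_plus (V := R_NormedModule)).
Qed.

Lemma ex_dot u v : in_l2 u -> in_l2 v -> ex_series (fun n => dot (u n) (v n)).
Proof.
  intros Hu Hv. apply (ex_series_dominated _ _ (fun n => dot_le (u n) (v n))).
  now apply ex_modmod.
Qed.

Lemma in_l2_scal c u : in_l2 u -> in_l2 (seq_scal c u).
Proof.
  intros Hu. unfold in_l2, seq_scal.
  apply (ex_series_ext (fun n => Cmod c ^ 2 * Cmod (u n) ^ 2)).
  - intros n. rewrite Cmod_mult. symmetry. apply Rpow_mult_distr.
  - now apply (ex_series_scal (V := R_NormedModule) (Cmod c ^ 2)).
Qed.

Lemma in_l2_plus u v : in_l2 u -> in_l2 v -> in_l2 (seq_plus u v).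
Proof.
  intros Hu Hv. unfold in_l2, seq_plus.
  apply (ex_series_dominated _ (fun n => 2 * (Cmod (u n) ^ 2 + Cmod (v n) ^ 2))).
  - intros n. rewrite Rabs_pos_eq by apply pow2_ge_0. rewrite !Cmod2_alt. simpl.
    assert (0 <= (Re (u n) - Re (v n)) ^ 2) by apply pow2_ge_0.
    assert (0 <= (Im (u n) - Im (v n)) ^ 2) by apply pow2_ge_0.
    unfold Re, Im in *. nra.
  - apply (ex_series_scal (V := R_NormedModule) 2).
    now apply (ex_series_plus (V := R_NormedModule)).
Qed.

Lemma in_l2_opp u : in_l2 u -> in_l2 (seq_opp u).
Proof.
  intros Hu. replace (seq_opp u) with (seq_scal (RtoC (-1)) u) by seq_eq.
  now apply in_l2_scal.
Qed.

Lemma in_l2_minus u v : in_l2 u -> in_l2 v -> in_l2 (seq_minus u v).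
Proof. intros. apply in_l2_plus; [|apply in_l2_opp]; assumption. Qed.

Lemma in_l2_finite u N : (forall n, (N < n)%nat -> u n = RtoC 0) -> in_l2 u.
Proof.
  intros H. exists (sum_n (fun n => Cmod (u n) ^ 2) N). apply Series_eventually_zero.
  intros n Hn. rewrite H by assumption. rewrite Cmod_0. ring.
Qed.

Lemma in_l2_zero : in_l2 zeroseq.
Proof. now apply (in_l2_finite _ 0). Qed.

Create HintDb l2.
Hint Resolve in_l2_scal in_l2_plus in_l2_opp in_l2_minus in_l2_zero : l2.

Lemma ip_sym u v : ip u v = ip v u.
Proof. apply Series_ext. intros n. apply dot_sym. Qed.

Lemma ip_plus_l u v w : in_l2 u -> in_l2 v -> in_l2 w ->
  ip (seq_plus u v) w = ip u w + ip v w.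
Proof.
  intros. unfold ip. rewrite <- Series_plus by now apply ex_dot.
  apply Series_ext. intros n. apply dot_plus_l.
Qed.

Lemma ip_scal_l r u w : ip (seq_scal (RtoC r) u) w = r * ip u w.
Proof.
  unfold ip. rewrite <- Series_scal_l. apply Series_ext. intros n. apply dot_real_l.
Qed.

Lemma ip_opp_l u w : ip (seq_opp u) w = - ip u w.
Proof.
  replace (seq_opp u) with (seq_scal (RtoC (-1)) u) by seq_eq. rewrite ip_scal_l. ring.
Qed.

Lemma ip_minus_l u v w : in_l2 u -> in_l2 v -> in_l2 w ->
  ip (seq_minus u v) w = ip u w - ip v w.
Proof. intros. unfold seq_minus. rewrite ip_plus_l, ip_opp_l by auto with l2. ring. Qed.

Lemma ip_plus_r u v w : in_l2 u -> in_l2 v -> in_l2 w ->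
  ip w (seq_plus u v) = ip w u + ip w v.
Proof. intros. rewrite ip_sym, ip_plus_l by auto. now rewrite (ip_sym u), (ip_sym v). Qed.

Lemma ip_scal_r r u w : ip w (seq_scal (RtoC r) u) = r * ip w u.
Proof. now rewrite ip_sym, ip_scal_l, ip_sym. Qed.

Lemma ip_minus_r u v w : in_l2 u -> in_l2 v -> in_l2 w ->
  ip w (seq_minus u v) = ip w u - ip w v.
Proof. intros. rewrite ip_sym, ip_minus_l by auto. now rewrite (ip_sym u), (ip_sym v). Qed.

Lemma ip_mult_l c u v : ip (seq_scal c u) v = ip u (seq_scal (Cconj c) v).
Proof. apply Series_ext. intros n. apply dot_mult_l. Qed.

Lemma l2_norm_pos u : 0 <= l2_norm u.
Proof. apply sqrt_pos. Qed.

Lemma l2_norm_sq u : in_l2 u -> l2_norm u ^ 2 = ip u u.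
Proof.
  intros Hu. unfold l2_norm. rewrite pow2_sqrt.
  - apply Series_ext. intros n. apply Cmod_sq.
  - eapply Rle_trans; [|apply (sum_le_Series _ 0)].
    + rewrite sum_O. apply pow2_ge_0.
    + intros. apply pow2_ge_0.
    + assumption.
Qed.

Lemma norm_le_of_sq u B : in_l2 u -> 0 <= B -> ip u u <= B ^ 2 -> l2_norm u <= B.
Proof.
  intros Hu HB H. rewrite <- l2_norm_sq in H by assumption.
  assert (H0 := l2_norm_pos u). nra.
Qed.

Lemma cauchy_schwarz u v : in_l2 u -> in_l2 v -> Rabs (ip u v) <= l2_norm u * l2_norm v.
Proof.
  intros Hu Hv.
  assert (Q : forall x, 0 <= l2_norm u ^ 2 * x ^ 2 + 2 * x * ip u v + l2_norm v ^ 2).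
  { intros x. assert (H := pow2_ge_0 (l2_norm (seq_plus (seq_scal (RtoC x) u) v))).
    rewrite l2_norm_sq in H by auto with l2.
    rewrite ip_plus_l, !ip_plus_r, !ip_scal_l, !ip_scal_r in H by auto with l2.
    rewrite !l2_norm_sq by assumption. rewrite (ip_sym v u) in H. nra. }
  assert (H1 := l2_norm_pos u). assert (H2 := l2_norm_pos v).
  set (a := l2_norm u) in *. set (b := l2_norm v) in *. set (p := ip u v) in *.
  assert (Hab : 0 <= a * b) by nra.
  apply Rsqr_incr_0_var; [|assumption]. rewrite <- Rsqr_abs. unfold Rsqr.
  destruct (Req_dec a 0) as [Ha|Ha].
  - destruct (Req_dec p 0) as [Hp|Hp]; [rewrite Hp; nra|].
    specialize (Q (- (b ^ 2 + 1) / (2 * p))). rewrite Ha in Q.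
    replace (0 ^ 2 * (- (b ^ 2 + 1) / (2 * p)) ^ 2 + 2 * (- (b ^ 2 + 1) / (2 * p)) * p + b ^ 2)
      with (-1) in Q by (field; assumption). lra.
  - specialize (Q (- p / a ^ 2)).
    replace (a ^ 2 * (- p / a ^ 2) ^ 2 + 2 * (- p / a ^ 2) * p + b ^ 2)
      with ((a * b * (a * b) - p * p) / a ^ 2) in Q by (field; assumption).
    assert (0 < a ^ 2) by nra.
    apply (Rmult_le_compat_r (a ^ 2)) in Q; [|lra].
    unfold Rdiv in Q. rewrite Rmult_assoc, Rinv_l in Q by lra. lra.
Qed.

Lemma l2_norm_plus u v : in_l2 u -> in_l2 v ->
  l2_norm (seq_plus u v) <= l2_norm u + l2_norm v.
Proof.
  intros Hu Hv. assert (H1 := l2_norm_pos u). assert (H2 := l2_norm_pos v).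
  apply norm_le_of_sq; [auto with l2|lra|].
  rewrite ip_plus_l, !ip_plus_r by auto with l2. rewrite (ip_sym v u).
  assert (H := cauchy_schwarz u v Hu Hv). assert (H3 := Rle_abs (ip u v)).
  assert (H4 := l2_norm_sq u Hu). assert (H5 := l2_norm_sq v Hv). nra.
Qed.

Lemma l2_norm_scal r u : in_l2 u -> l2_norm (seq_scal (RtoC r) u) = Rabs r * l2_norm u.
Proof.
  intros Hu. unfold l2_norm, seq_scal.
  rewrite (Series_ext _ (fun n => r ^ 2 * Cmod (u n) ^ 2)).
  - rewrite Series_scal_l, sqrt_mult_alt by apply pow2_ge_0.
    rewrite <- (sqrt_Rsqr_abs r). unfold Rsqr. do 3 f_equal. ring.
  - intros n. rewrite Cmod_mult, Cmod_R, Rpow_mult_distr, pow2_abs. reflexivity.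
Qed.

Lemma l2_norm_opp u : in_l2 u -> l2_norm (seq_opp u) = l2_norm u.
Proof.
  intros Hu. replace (seq_opp u) with (seq_scal (RtoC (-1)) u) by seq_eq.
  rewrite l2_norm_scal by assumption. rewrite Rabs_left by lra. ring.
Qed.

Lemma l2_norm_minus u v : in_l2 u -> in_l2 v ->
  l2_norm (seq_minus u v) <= l2_norm u + l2_norm v.
Proof.
  intros. unfold seq_minus. eapply Rle_trans; [apply l2_norm_plus; auto with l2|].
  rewrite l2_norm_opp by assumption. lra.
Qed.

Lemma l2_norm_zero : l2_norm zeroseq = 0.
Proof.
  replace zeroseq with (seq_scal (RtoC 0) zeroseq) by seq_eq.
  rewrite l2_norm_scal by apply in_l2_zero. rewrite Rabs_R0. ring.
Qed.

Lemma coord_le_norm u n : in_l2 u -> Cmod (u n) <= l2_norm u.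
Proof.
  intros Hu. rewrite <- (sqrt_Rsqr (Cmod (u n))) by apply Cmod_ge_0.
  apply sqrt_le_1_alt. eapply Rle_trans; [|apply (sum_le_Series _ n)].
  - assert (H : forall k, 0 <= Cmod (u k) ^ 2) by (intros; apply pow2_ge_0).
    unfold Rsqr. destruct n as [|n]; [rewrite sum_O|rewrite sum_succ].
    + lra.
    + assert (0 <= sum_n (fun k => Cmod (u k) ^ 2) n) by now apply sum_nonneg. lra.
  - intros. apply pow2_ge_0.
  - assumption.
Qed.

(** * Finitely supported sequences *)

Definition delta (c : C) (n : nat) : cseq := fun m => if Nat.eqb m n then c else RtoC 0.

Definition trunc (N : nat) (u : cseq) : cseq := fun n => if Nat.leb n N then u n else RtoC 0.

Lemma in_l2_delta c n : in_l2 (delta c n).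
Proof.
  apply (in_l2_finite _ n). intros m Hm. unfold delta.
  rewrite (proj2 (Nat.eqb_neq m n)) by lia. reflexivity.
Qed.

Lemma in_l2_trunc N u : in_l2 (trunc N u).
Proof.
  apply (in_l2_finite _ N). intros m Hm. unfold trunc.
  rewrite (proj2 (Nat.leb_gt m N)) by lia. reflexivity.
Qed.
Hint Resolve in_l2_delta in_l2_trunc : l2.

Lemma trunc_le N u n : (n <= N)%nat -> trunc N u n = u n.
Proof. intros. unfold trunc. now rewrite (proj2 (Nat.leb_le n N)). Qed.

Lemma trunc_gt N u n : (N < n)%nat -> trunc N u n = RtoC 0.
Proof. intros. unfold trunc. now rewrite (proj2 (Nat.leb_gt n N)). Qed.

Lemma trunc_induct (P : cseq -> Prop) :
  (forall c n, P (delta c n)) -> (forall u v, P u -> P v -> P (seq_plus u v)) ->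
  forall N u, P (trunc N u).
Proof.
  intros Hd Hp N u. induction N as [|N IH].
  - replace (trunc 0 u) with (delta (u 0%nat) 0); [apply Hd|].
    apply functional_extensionality. intros [|n]; reflexivity.
  - replace (trunc (S N) u) with (seq_plus (trunc N u) (delta (u (S N)) (S N))); [auto|].
    apply functional_extensionality. intros n. unfold seq_plus, trunc, delta.
    destruct (Nat.eqb_spec n (S N)) as [->|Hn].
    + rewrite Nat.leb_refl. rewrite (proj2 (Nat.leb_gt (S N) N)) by lia. apply Cplus_0_l.
    + destruct (Nat.leb_spec n N) as [Hle|Hgt].
      * rewrite (proj2 (Nat.leb_le n (S N))) by lia. apply Cplus_0_r.
      * rewrite (proj2 (Nat.leb_gt n (S N))) by lia. apply Cplus_0_r.
Qed.

Lemma ip_finite u v N : (forall n, (N < n)%nat -> u n = RtoC 0) ->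
  ip u v = sum_n (fun n => dot (u n) (v n)) N.
Proof.
  intros H. apply is_series_unique, Series_eventually_zero.
  intros n Hn. rewrite H by assumption. unfold dot. simpl. ring.
Qed.

Lemma ip_trunc N u v : ip (trunc N u) v = sum_n (fun n => dot (u n) (v n)) N.
Proof.
  rewrite (ip_finite _ _ N) by apply trunc_gt.
  apply sum_ext_le. intros n Hn. now rewrite trunc_le.
Qed.

Lemma ip_delta c n v : ip (delta c n) v = dot c (v n).
Proof.
  rewrite (ip_finite _ _ n).
  - rewrite sum_last; unfold delta; [now rewrite Nat.eqb_refl|].
    intros k Hk. rewrite (proj2 (Nat.eqb_neq k n)) by lia. unfold dot. simpl. ring.
  - intros m Hm. unfold delta. rewrite (proj2 (Nat.eqb_neq m n)) by lia. reflexivity.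
Qed.

Lemma trunc_norm_sq N u : l2_norm (trunc N u) ^ 2 = sum_n (fun n => dot (u n) (u n)) N.
Proof.
  rewrite l2_norm_sq, ip_trunc by auto with l2.
  apply sum_ext_le. intros n Hn. now rewrite trunc_le.
Qed.

Lemma trunc_norm_le N u : in_l2 u -> l2_norm (trunc N u) <= l2_norm u.
Proof.
  intros Hu. assert (H1 := l2_norm_pos u).
  apply norm_le_of_sq; auto with l2. rewrite <- l2_norm_sq, trunc_norm_sq by auto with l2.
  rewrite l2_norm_sq by assumption. apply sum_le_Series.
  - intros n. rewrite <- Cmod_sq. apply pow2_ge_0.
  - now apply ex_dot.
Qed.

Lemma l2_of_trunc u B : 0 <= B -> (forall N, l2_norm (trunc N u) <= B) ->
  in_l2 u /\ l2_norm u <= B.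
Proof.
  intros HB H.
  assert (Hs : forall N, sum_n (fun n => dot (u n) (u n)) N <= B ^ 2).
  { intros N. rewrite <- trunc_norm_sq. assert (H0 := l2_norm_pos (trunc N u)).
    specialize (H N). nra. }
  assert (Hu : in_l2 u).
  { apply (ex_series_ext (fun n => dot (u n) (u n))).
    - intros n. now rewrite Cmod_sq.
    - apply (ex_series_bounded _ (B ^ 2)); [|assumption].
      intros n. rewrite <- Cmod_sq. apply pow2_ge_0. }
  split; [assumption|]. apply norm_le_of_sq; [assumption..|].
  apply Series_le_bound; [now apply ex_dot|assumption].
Qed.

(** A norm bound may be tested against finitely supported sequences: take the
    truncation of [u] itself as test sequence. *)
Lemma norm_le_test u B : 0 <= B ->
  (forall N f, Rabs (ip (trunc N f) u) <= B * l2_norm (trunc N f)) ->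
  in_l2 u /\ l2_norm u <= B.
Proof.
  intros HB H. apply l2_of_trunc; [assumption|]. intros N.
  specialize (H N u). rewrite ip_trunc, <- trunc_norm_sq in H.
  assert (H0 := l2_norm_pos (trunc N u)).
  rewrite Rabs_pos_eq in H by apply pow2_ge_0.
  destruct (Req_dec (l2_norm (trunc N u)) 0) as [E|E]; nra.
Qed.

Lemma trunc_dense u eps : in_l2 u -> 0 < eps ->
  exists N, l2_norm (seq_minus u (trunc N u)) <= eps.
Proof.
  intros Hu He.
  assert (Hl : is_lim_seq (sum_n (fun n => dot (u n) (u n))) (ip u u)).
  { apply Series_correct. now apply ex_dot. }
  apply is_lim_seq_spec in Hl. assert (He2 : 0 < eps ^ 2) by nra.
  destruct (Hl (mkposreal _ He2)) as [N HN]. exists N. specialize (HN N (le_n _)). simpl in HN.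
  apply norm_le_of_sq; [auto with l2|lra|].
  rewrite ip_minus_l, !ip_minus_r by auto with l2.
  rewrite (ip_sym u (trunc N u)), <- (l2_norm_sq (trunc N u)), trunc_norm_sq, ip_trunc by auto with l2.
  apply Rabs_def2 in HN. simpl. lra.
Qed.


(** * Calculus on a compact interval *)

(** One-sided at the end points, since semigroups live on [0, +oo) only. *)
Definition der_within (a b : R) (f : R -> R) (s l : R) : Prop :=
  forall eps, 0 < eps -> exists eta, 0 < eta /\
    forall r, a <= r <= b -> Rabs (r - s) < eta ->
      Rabs (f r - f s - (r - s) * l) <= eps * Rabs (r - s).

Lemma is_derive_within a b f s l : is_derive f s l -> der_within a b f s l.
Proof.
  intros H eps He. apply is_derive_Reals in H.
  destruct (H eps He) as [d Hd]. exists d. split; [apply cond_pos|].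
  intros r _ Hr. destruct (Req_dec r s) as [->|Hrs].
  - replace (f s - f s - (s - s) * l) with 0 by ring. rewrite Rabs_R0.
    apply Rmult_le_pos; [lra|apply Rabs_pos].
  - specialize (Hd (r - s) ltac:(lra) Hr). replace (s + (r - s)) with r in Hd by ring.
    replace (f r - f s - (r - s) * l) with (((f r - f s) / (r - s) - l) * (r - s))
      by (field; lra).
    rewrite Rabs_mult. apply Rmult_le_compat_r; [apply Rabs_pos|lra].
Qed.

Lemma mean_value a b f df : a <= b ->
  (forall s, a <= s <= b -> der_within a b f s (df s)) ->
  exists c, a <= c <= b /\ f b - f a = df c * (b - a).
Proof.
  intros Hab H.
  (* Extending f by constants makes it continuous at the end points. *)
  set (cl := fun r => Rmax a (Rmin r b)).
  assert (Hcl : forall r, a <= cl r <= b).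
  { intros r. unfold cl, Rmax, Rmin. destruct (Rle_dec r b), (Rle_dec a _); lra. }
  assert (Hid : forall r, a <= r <= b -> cl r = r).
  { intros r Hr. unfold cl, Rmax, Rmin. destruct (Rle_dec r b), (Rle_dec a _); lra. }
  assert (Hlip : forall r s, a <= s <= b -> Rabs (cl r - s) <= Rabs (r - s)).
  { intros r s Hs. unfold cl, Rmax, Rmin, Rabs.
    repeat (destruct (Rle_dec _ _) || destruct (Rcase_abs _)); lra. }
  destruct (MVT_gen (fun r => f (cl r)) a b df) as [c [Hc E]].
  - rewrite Rmin_left, Rmax_right by assumption. intros x Hx.
    apply is_derive_Reals. intros eps He.
    destruct (H x ltac:(lra) (eps / 2) ltac:(lra)) as [eta [Heta Hd]].
    assert (Hm : 0 < Rmin eta (Rmin (x - a) (b - x))) by (repeat apply Rmin_glb_lt; lra).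
    exists (mkposreal _ Hm). intros h Hh Hhm. simpl in Hhm.
    assert (Hh1 := Rlt_le_trans _ _ _ Hhm (Rmin_l _ _)).
    assert (Hh2 := Rlt_le_trans _ _ _ Hhm (Rmin_r _ _)).
    assert (Hh3 := Rlt_le_trans _ _ _ Hh2 (Rmin_l _ _)).
    assert (Hh4 := Rlt_le_trans _ _ _ Hh2 (Rmin_r _ _)).
    apply Rabs_def2 in Hh3. apply Rabs_def2 in Hh4.
    rewrite (Hid x), (Hid (x + h)) by lra.
    specialize (Hd (x + h) ltac:(lra)). replace (x + h - x) with h in Hd by ring.
    specialize (Hd Hh1).
    replace ((f (x + h) - f x) / h - df x) with ((f (x + h) - f x - h * df x) / h)
      by (field; assumption).
    unfold Rdiv. rewrite Rabs_mult, Rabs_inv.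
    assert (Hp : 0 < Rabs h) by now apply Rabs_pos_lt.
    apply Rle_lt_trans with (eps / 2); [|lra].
    apply (Rmult_le_reg_r (Rabs h)); [assumption|].
    rewrite Rmult_assoc, Rinv_l, Rmult_1_r by lra. assumption.
  - rewrite Rmin_left, Rmax_right by assumption. intros x Hx eps He.
    destruct (H x Hx 1 ltac:(lra)) as [eta [Heta Hd]].
    assert (HL : 0 < Rabs (df x) + 1) by (assert (H0 := Rabs_pos (df x)); lra).
    exists (Rmin eta (eps / (Rabs (df x) + 1))). split.
    { apply Rmin_glb_lt; [lra|]. now apply Rdiv_lt_0_compat. }
    intros r [_ Hr]. simpl in *. unfold Rdist in *.
    assert (Hr1 := Rlt_le_trans _ _ _ Hr (Rmin_l _ _)).
    assert (Hr2 := Rlt_le_trans _ _ _ Hr (Rmin_r _ _)).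
    rewrite (Hid x) by assumption.
    specialize (Hlip r x Hx). specialize (Hd (cl r) (Hcl r) ltac:(lra)).
    set (q := cl r) in *.
    replace (f q - f x) with ((f q - f x - (q - x) * df x) + (q - x) * df x) by ring.
    eapply Rle_lt_trans; [apply Rabs_triang|]. rewrite (Rabs_mult (q - x)).
    apply (Rmult_lt_compat_r (Rabs (df x) + 1)) in Hr2; [|assumption].
    unfold Rdiv in Hr2. rewrite Rmult_assoc, Rinv_l, Rmult_1_r in Hr2 by lra.
    assert (H0 := Rabs_pos (df x)). nra.
  - rewrite Rmin_left, Rmax_right in Hc by assumption.
    rewrite (Hid a), (Hid b) in E by lra. now exists c.
Qed.

Definition seq_der_within (a b : R) (F : R -> cseq) (s : R) (F' : cseq) : Prop :=
  forall eps, 0 < eps -> exists eta, 0 < eta /\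
    forall r, a <= r <= b -> Rabs (r - s) < eta ->
      l2_norm (seq_minus (seq_minus (F r) (F s)) (seq_scal (RtoC (r - s)) F'))
        <= eps * Rabs (r - s).

Lemma ip_der_within a b F G s F' G' :
  (forall r, a <= r <= b -> in_l2 (F r)) -> (forall r, a <= r <= b -> in_l2 (G r)) ->
  in_l2 F' -> in_l2 G' -> a <= s <= b ->
  seq_der_within a b F s F' -> seq_der_within a b G s G' ->
  der_within a b (fun r => ip (F r) (G r)) s (ip F' (G s) + ip (F s) G').
Proof.
  intros HF HG HF' HG' Hs DF DG eps He.
  assert (P1 := l2_norm_pos F'). assert (P2 := l2_norm_pos G').
  assert (P3 := l2_norm_pos (F s)). assert (P4 := l2_norm_pos (G s)).
  set (K := (l2_norm (G s) + l2_norm G' + 1) + l2_norm F' * (l2_norm G' + 1)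
            + l2_norm (F s) + 1).
  assert (HK : 1 <= K) by (unfold K; nra).
  set (e := Rmin 1 (eps / K)).
  assert (He1 : 0 < e) by (apply Rmin_glb_lt; [lra|apply Rdiv_lt_0_compat; lra]).
  assert (He2 : e <= 1) by apply Rmin_l.
  assert (He3 : e * K <= eps).
  { apply Rle_trans with (eps / K * K); [apply Rmult_le_compat_r; [lra|apply Rmin_r]|].
    right; field; lra. }
  destruct (DF e He1) as [n1 [Hn1 D1]]. destruct (DG e He1) as [n2 [Hn2 D2]].
  exists (Rmin e (Rmin n1 n2)). split; [repeat (apply Rmin_glb_lt; try assumption)|].
  intros r Hr Hrs.
  assert (Hrs0 := Rlt_le_trans _ _ _ Hrs (Rmin_l _ _)).
  assert (Hrs3 := Rlt_le_trans _ _ _ Hrs (Rmin_r _ _)).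
  assert (Hrs1 := Rlt_le_trans _ _ _ Hrs3 (Rmin_l _ _)).
  assert (Hrs2 := Rlt_le_trans _ _ _ Hrs3 (Rmin_r _ _)).
  specialize (D1 r Hr Hrs1). specialize (D2 r Hr Hrs2).
  set (X := seq_minus (seq_minus (F r) (F s)) (seq_scal (RtoC (r - s)) F')) in *.
  set (Y := seq_minus (seq_minus (G r) (G s)) (seq_scal (RtoC (r - s)) G')) in *.
  assert (I1 := HF r Hr). assert (I2 := HF s Hs).
  assert (I3 := HG r Hr). assert (I4 := HG s Hs).
  assert (IX : in_l2 X) by (unfold X; auto with l2).
  assert (IY : in_l2 Y) by (unfold Y; auto with l2).
  set (h := r - s) in *. set (ah := Rabs h) in *. assert (Hah : 0 <= ah) by apply Rabs_pos.
  set (Z := seq_minus (G r) (G s)).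
  assert (IZ : in_l2 Z) by (unfold Z; auto with l2).
  assert (EZ : Z = seq_plus Y (seq_scal (RtoC h) G')) by (unfold Y, Z; seq_eq).
  assert (NZ : l2_norm Z <= ah * (l2_norm G' + 1)).
  { rewrite EZ. eapply Rle_trans; [apply l2_norm_plus; auto with l2|].
    rewrite l2_norm_scal by assumption. fold ah. nra. }
  assert (NG : l2_norm (G r) <= l2_norm (G s) + l2_norm G' + 1).
  { replace (G r) with (seq_plus (G s) Z) by (unfold Z; seq_eq).
    eapply Rle_trans; [apply l2_norm_plus; auto with l2|]. nra. }
  replace (ip (F r) (G r) - ip (F s) (G s) - h * (ip F' (G s) + ip (F s) G'))
    with (ip X (G r) + h * ip F' Z + ip (F s) Y).
  2: { unfold X, Y, Z.
       rewrite !ip_minus_l, !ip_minus_r, !ip_scal_l, !ip_scal_r by auto with l2. ring. }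
  assert (C1 := cauchy_schwarz X (G r) IX I3).
  assert (C2 := cauchy_schwarz F' Z HF' IZ).
  assert (C3 := cauchy_schwarz (F s) Y I2 IY).
  assert (Q1 := l2_norm_pos X). assert (Q2 := l2_norm_pos Y).
  assert (Q3 := l2_norm_pos Z). assert (Q4 := l2_norm_pos (G r)).
  assert (B1 : Rabs (ip X (G r)) <= ah * (e * (l2_norm (G s) + l2_norm G' + 1))).
  { eapply Rle_trans; [exact C1|]. eapply Rle_trans.
    - apply Rmult_le_compat; [assumption..|exact D1|exact NG].
    - right; ring. }
  assert (B2 : Rabs (h * ip F' Z) <= ah * (e * (l2_norm F' * (l2_norm G' + 1)))).
  { rewrite Rabs_mult. fold ah.
    assert (Rabs (ip F' Z) <= l2_norm F' * (ah * (l2_norm G' + 1))).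
    { eapply Rle_trans; [exact C2|]. now apply Rmult_le_compat_l. }
    assert (0 <= l2_norm F' * (l2_norm G' + 1)) by nra.
    apply Rmult_le_compat_l; [assumption|]. nra. }
  assert (B3 : Rabs (ip (F s) Y) <= ah * (e * l2_norm (F s))).
  { eapply Rle_trans; [exact C3|]. nra. }
  eapply Rle_trans; [apply Rabs_triang|].
  assert (B4 := Rabs_triang (ip X (G r)) (h * ip F' Z)).
  assert (ah * (e * K) <= eps * ah) by nra.
  unfold K in *. nra.
Qed.

(** * Completeness *)

(** Cantor's intersection theorem for closed balls of l^2; the common point is
    the entrywise limit of the centres. *)
Lemma nested_balls (x : nat -> cseq) (r : nat -> R) :
  (forall n, in_l2 (x n)) -> (forall n, 0 < r n) -> (forall n, r (S n) <= r n / 2) ->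
  (forall n, l2_norm (seq_minus (x (S n)) (x n)) <= r n / 2) ->
  exists y, in_l2 y /\ forall n, l2_norm (seq_minus y (x n)) <= r n.
Proof.
  intros Hx Hr Hr2 Hstep.
  assert (Hk : forall k n, l2_norm (seq_minus (x (n + k)%nat) (x n)) <= r n - r (n + k)%nat).
  { induction k as [|k IH]; intros n.
    - rewrite Nat.add_0_r. replace (seq_minus (x n) (x n)) with zeroseq by seq_eq.
      rewrite l2_norm_zero. lra.
    - rewrite Nat.add_succ_r.
      replace (seq_minus (x (S (n + k))) (x n)) with
        (seq_plus (seq_minus (x (S (n + k))) (x (n + k)%nat)) (seq_minus (x (n + k)%nat) (x n)))
        by seq_eq.
      eapply Rle_trans; [apply l2_norm_plus; auto with l2|].
      specialize (IH n). specialize (Hstep (n + k)%nat). specialize (Hr2 (n + k)%nat). lra. }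
  assert (Hk' : forall n m, (n <= m)%nat -> l2_norm (seq_minus (x m) (x n)) <= r n).
  { intros n m Hnm. specialize (Hk (m - n)%nat n). replace (n + (m - n))%nat with m in Hk by lia.
    specialize (Hr m). lra. }
  assert (Hr0 : forall eps, 0 < eps -> exists N, forall n, (N <= n)%nat -> r n < eps).
  { assert (Hp : forall n, r n <= r 0%nat * (/ 2) ^ n).
    { induction n as [|n IH]; simpl; [lra|]. specialize (Hr2 n). nra. }
    intros eps He. destruct (pow_lt_1_zero (/ 2)) with (y := eps / r 0%nat) as [N HN].
    - rewrite Rabs_pos_eq; lra.
    - apply Rdiv_lt_0_compat; auto.
    - exists N. intros n Hn. specialize (HN n Hn).
      rewrite Rabs_pos_eq in HN by (apply pow_le; lra).
      apply (Rmult_lt_compat_l (r 0%nat)) in HN; [|auto].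
      replace (r 0%nat * (eps / r 0%nat)) with eps in HN
        by (field; specialize (Hr 0%nat); lra).
      specialize (Hp n). lra. }
  assert (Hcv : forall (g : C -> R), (forall z w, Rabs (g z - g w) <= Cmod (z - w)%C) ->
    forall n, exists l : R, is_lim_seq (fun k => g (x k n)) l).
  { intros g Hg n. apply ex_lim_seq_cauchy_corr. intros eps.
    destruct (Hr0 (eps / 2) ltac:(destruct eps; simpl; lra)) as [N HN].
    assert (Hn : forall p, (N <= p)%nat -> Rabs (g (x p n) - g (x N n)) < eps / 2).
    { intros p Hp. eapply Rle_lt_trans; [apply Hg|].
      eapply Rle_lt_trans; [|apply (HN N (le_n _))].
      eapply Rle_trans; [|apply (Hk' N p Hp)].
      apply (coord_le_norm (seq_minus (x p) (x N)) n). auto with l2. }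
    exists N. intros p q Hp Hq. assert (H1 := Hn p Hp). assert (H2 := Hn q Hq).
    apply Rabs_def2 in H1. apply Rabs_def2 in H2. apply Rabs_def1; lra. }
  assert (HRe : forall z w, Rabs (Re z - Re w) <= Cmod (z - w)%C).
  { intros z w. exact (re_le_Cmod (z - w)%C). }
  assert (HIm : forall z w, Rabs (Im z - Im w) <= Cmod (z - w)%C).
  { intros z w. eapply Rle_trans; [|apply Rmax_Cmod]. apply Rmax_r. }
  destruct (choice _ (Hcv Re HRe)) as [yr Hyr].
  destruct (choice _ (Hcv Im HIm)) as [yi Hyi].
  set (y := (fun n => (yr n, yi n)) : cseq).
  assert (Hy : forall n, in_l2 (seq_minus y (x n)) /\ l2_norm (seq_minus y (x n)) <= r n).
  { intros n. apply l2_of_trunc; [left; apply Hr|]. intros N.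
    assert (Hrn := Hr n).
    apply norm_le_of_sq; [auto with l2|lra|].
    rewrite <- l2_norm_sq, trunc_norm_sq by auto with l2.
    set (d := fun k => seq_minus (x k) (x n)).
    assert (Hlim : is_lim_seq (fun k => sum_n (fun j => dot (d k j) (d k j)) N)
                     (sum_n (fun j => dot (seq_minus y (x n) j) (seq_minus y (x n) j)) N)).
    { assert (Hj : forall j, is_lim_seq (fun k => dot (d k j) (d k j))
                     (dot (seq_minus y (x n) j) (seq_minus y (x n) j))).
      { intros j. unfold dot.
        assert (Lr : is_lim_seq (fun k => Re (d k j)) (Re (seq_minus y (x n) j))).
        { apply is_lim_seq_plus'; [apply (Hyr j)|apply is_lim_seq_const]. }
        assert (Li : is_lim_seq (fun k => Im (d k j)) (Im (seq_minus y (x n) j))).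
        { apply is_lim_seq_plus'; [apply (Hyi j)|apply is_lim_seq_const]. }
        apply is_lim_seq_plus'; apply is_lim_seq_mult'; assumption. }
      induction N as [|N IH].
      - rewrite sum_O. apply (is_lim_seq_ext (fun k => dot (d k 0%nat) (d k 0%nat))).
        + intros k. now rewrite sum_O.
        + apply Hj.
      - rewrite sum_succ. eapply is_lim_seq_ext.
        + intros k. symmetry. apply sum_succ.
        + apply is_lim_seq_plus'; [apply IH|apply Hj]. }
    refine (is_lim_seq_le_loc _ (fun _ => r n ^ 2) _ (r n ^ 2) _ Hlim (is_lim_seq_const _)).
    exists n. intros k Hnk. rewrite <- trunc_norm_sq. unfold d.
    assert (H0 := l2_norm_pos (trunc N (seq_minus (x k) (x n)))).
    assert (H1 := trunc_norm_le N (seq_minus (x k) (x n)) ltac:(auto with l2)).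
    assert (H2 := Hk' n k Hnk). nra. }
  exists y. split; [|apply Hy].
  replace y with (seq_plus (seq_minus y (x 0%nat)) (x 0%nat)).
  - apply in_l2_plus; [apply Hy|apply Hx].
  - seq_eq.
Qed.


(** * Symmetry of the Laguerre matrix on its maximal domain *)

Definition offdiag (alpha : R) (n : nat) : R := sqrt ((INR n + 1) * (INR n + 1 + alpha)).

Lemma dot_tau_succ alpha u v n :
  dot (tau alpha u (S n)) (v (S n)) =
  (2 * INR (S n) + 1 + alpha) * dot (u (S n)) (v (S n))
  - offdiag alpha n * dot (u n) (v (S n))
  - offdiag alpha (S n) * dot (u (S (S n))) (v (S n)).
Proof.
  unfold tau, prev, offdiag. rewrite S_INR.
  set (x := sqrt _). set (y := sqrt _).
  unfold dot, Re, Im, Cminus, Copp, Cplus, Cmult, RtoC; simpl; ring.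
Qed.

Lemma dot_tau_0 alpha u v :
  dot (tau alpha u 0%nat) (v 0%nat) =
  (2 * INR 0 + 1 + alpha) * dot (u 0%nat) (v 0%nat)
  - offdiag alpha 0 * dot (u 1%nat) (v 0%nat).
Proof.
  unfold tau, prev, offdiag. set (x := sqrt _). set (y := sqrt _).
  unfold dot, Re, Im, Cminus, Copp, Cplus, Cmult, RtoC; simpl; ring.
Qed.

(** Green's formula: the two sides differ by the Wronskian at the cut-off. *)
Lemma green alpha u v N :
  sum_n (fun n => dot (tau alpha u n) (v n)) N - sum_n (fun n => dot (u n) (tau alpha v n)) N
  = offdiag alpha N * (dot (u N) (v (S N)) - dot (u (S N)) (v N)).
Proof.
  induction N as [|N IH].
  - rewrite !sum_O, dot_tau_0, (dot_sym (u 0%nat) (tau _ _ _)), dot_tau_0.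
    rewrite (dot_sym (v 0%nat) (u 0%nat)), (dot_sym (v 1%nat)). ring.
  - rewrite !sum_succ, dot_tau_succ, (dot_sym (u (S N)) (tau _ _ _)), dot_tau_succ.
    rewrite (dot_sym (v (S N)) (u (S N))), (dot_sym (v N)), (dot_sym (v (S (S N)))).
    match goal with |- ?a + ?b - (?c + ?d) = _ => replace (a + b - (c + d)) with (a - c + (b - d)) by ring end.
    rewrite IH. ring.
Qed.

Lemma tau_plus alpha u v : tau alpha (seq_plus u v) = seq_plus (tau alpha u) (tau alpha v).
Proof.
  apply functional_extensionality. intros n. unfold tau, seq_plus.
  destruct n as [|n]; unfold prev; ring.
Qed.

Lemma tau_delta_support alpha c n m : (S n < m)%nat -> tau alpha (delta c n) m = RtoC 0.
Proof.
  intros H. unfold tau, delta. destruct m as [|m]; [lia|]. unfold prev.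
  rewrite (proj2 (Nat.eqb_neq m n)), (proj2 (Nat.eqb_neq (S m) n)),
    (proj2 (Nat.eqb_neq (S (S m)) n)) by lia. ring.
Qed.

Lemma in_l2_tau_delta alpha c n : in_l2 (tau alpha (delta c n)).
Proof. apply (in_l2_finite _ (S n)). apply tau_delta_support. Qed.

Lemma ip_tau_delta alpha c n y : ip (tau alpha (delta c n)) y = dot c (tau alpha y n).
Proof.
  rewrite <- ip_delta.
  rewrite (ip_finite _ _ (S n)) by apply tau_delta_support.
  rewrite (ip_finite (delta c n) _ (S n)).
  - assert (H := green alpha (delta c n) y (S n)).
    replace (delta c n (S n)) with (RtoC 0) in H.
    replace (delta c n (S (S n))) with (RtoC 0) in H.
    + unfold dot at 3 4 in H. simpl in H. lra.
    + unfold delta. now rewrite (proj2 (Nat.eqb_neq (S (S n)) n)) by lia.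
    + unfold delta. now rewrite (proj2 (Nat.eqb_neq (S n) n)) by lia.
  - intros m Hm. unfold delta. now rewrite (proj2 (Nat.eqb_neq m n)) by lia.
Qed.

Lemma harmonic_not_summable (f : nat -> R) c N0 :
  ex_series f -> (forall n, (N0 <= n)%nat -> c <= f n * (INR n + 1)) -> c <= 0.
Proof.
  intros [l Hl] H. apply Rnot_lt_le. intros Hc.
  assert (Hl' : is_lim_seq (sum_n f) l) by exact Hl. apply is_lim_seq_spec in Hl'.
  assert (Hc4 : 0 < c / 4) by lra.
  destruct (Hl' (mkposreal _ Hc4)) as [N1 HN]. simpl in HN.
  set (M := (N0 + N1)%nat). assert (HM := pos_INR M).
  (* A dyadic block of the harmonic series is at least 1/2. *)
  assert (Hj : forall j, (j <= S M)%nat -> sum_n f M + INR j * (c / (2 * INR M + 2)) <= sum_n f (M + j)).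
  { induction j as [|j IH]; intros Hj.
    - rewrite Nat.add_0_r. simpl. lra.
    - rewrite Nat.add_succ_r, sum_succ, S_INR. specialize (IH ltac:(lia)).
      assert (c / (2 * INR M + 2) <= f (S (M + j))).
      { specialize (H (S (M + j)) ltac:(lia)).
        rewrite S_INR, plus_INR in H. assert (Hj' := pos_INR j).
        assert (Hj2 : INR j <= INR M) by (apply le_INR; lia).
        assert (0 < f (S (M + j))).
        { apply Rnot_le_lt. intros Hf. nra. }
        apply (Rmult_le_reg_r (2 * INR M + 2)); [lra|]. unfold Rdiv.
        rewrite Rmult_assoc, Rinv_l by lra. nra. }
      lra. }
  specialize (Hj (S M) (le_n _)). rewrite S_INR in Hj.
  replace ((INR M + 1) * (c / (2 * INR M + 2))) with (c / 2) in Hj by (field; lra).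
  assert (H1 := HN M ltac:(lia)). assert (H2 := HN (M + S M)%nat ltac:(lia)).
  apply Rabs_def2 in H1. apply Rabs_def2 in H2. lra.
Qed.

Lemma in_l2_shift u : in_l2 u -> in_l2 (fun n => u (S n)).
Proof. intros H. now apply (ex_series_incr_1 (fun n => Cmod (u n) ^ 2)). Qed.

(** The limit-point case at infinity: the Wronskian of two elements of the
    maximal domain converges, and its quotient by the off-diagonal entries is
    summable; as these grow linearly, the limit can only be zero (Carleman). *)
Lemma tau_symmetric alpha u v : -1 < alpha ->
  in_l2 u -> in_l2 v -> in_l2 (tau alpha u) -> in_l2 (tau alpha v) ->
  ip (tau alpha u) v = ip u (tau alpha v).
Proof.
  intros Ha Hu Hv Htu Htv.
  set (L := ip (tau alpha u) v - ip u (tau alpha v)).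
  set (W := fun N => offdiag alpha N * (dot (u N) (v (S N)) - dot (u (S N)) (v N))).
  assert (HW : is_lim_seq W L).
  { apply (is_lim_seq_ext (fun N => sum_n (fun n => dot (tau alpha u n) (v n)) N
                                   - sum_n (fun n => dot (u n) (tau alpha v n)) N)).
    - intros N. apply green.
    - apply is_lim_seq_minus'; apply Series_correct; now apply ex_dot. }
  set (K := 1 + Rabs alpha). assert (HK := Rabs_pos alpha).
  set (x := fun N => Cmod (u N) * Cmod (v (S N)) + Cmod (u (S N)) * Cmod (v N)).
  assert (Hx : ex_series x).
  { apply (ex_series_plus (V := R_NormedModule)).
    - apply (ex_modmod u (fun n => v (S n))); [assumption|now apply in_l2_shift].
    - apply (ex_modmod (fun n => u (S n)) v); [now apply in_l2_shift|assumption]. }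
  assert (HWx : forall N, Rabs (W N) <= K * (x N * (INR N + 1))).
  { intros N. unfold W. rewrite Rabs_mult.
    assert (HN := pos_INR N). assert (Ha1 := Rle_abs alpha).
    assert (H1 : Rabs (offdiag alpha N) <= K * (INR N + 1)).
    { unfold offdiag. rewrite Rabs_pos_eq by apply sqrt_pos.
      rewrite <- (sqrt_Rsqr (K * (INR N + 1))) by (unfold K; nra).
      apply sqrt_le_1_alt. unfold Rsqr, K. nra. }
    assert (H2 : Rabs (dot (u N) (v (S N)) - dot (u (S N)) (v N)) <= x N).
    { unfold Rminus. eapply Rle_trans; [apply Rabs_triang|]. rewrite Rabs_Ropp.
      apply Rplus_le_compat; apply dot_le. }
    replace (K * (x N * (INR N + 1))) with (K * (INR N + 1) * x N) by ring.
    apply Rmult_le_compat; auto using Rabs_pos. }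
  destruct (Req_dec L 0) as [E|E]; [unfold L in E; lra|exfalso].
  assert (HL : 0 < Rabs L / 2) by (apply Rabs_pos_lt in E; lra).
  apply is_lim_seq_spec in HW. destruct (HW (mkposreal _ HL)) as [N0 HN0]. simpl in HN0.
  assert (HKp : 0 < K) by (unfold K; lra).
  assert (Hc : Rabs L / 2 / K <= 0).
  { apply (harmonic_not_summable x _ N0 Hx). intros n Hn.
    specialize (HN0 n Hn). specialize (HWx n).
    assert (Rabs L <= Rabs (W n) + Rabs (W n - L)).
    { replace L with (W n + - (W n - L)) at 1 by ring.
      eapply Rle_trans; [apply Rabs_triang|]. rewrite Rabs_Ropp. lra. }
    apply (Rmult_le_reg_l K); [assumption|].
    replace (K * (Rabs L / 2 / K)) with (Rabs L / 2) by (field; lra). lra. }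
  assert (0 < Rabs L / 2 / K) by now apply Rdiv_lt_0_compat. lra.
Qed.


(** * The heat kernel *)

(** Coefficient of [z^k] in [(a + z)^m]. *)
Fixpoint pasc (a : R) (m k : nat) : R :=
  match m with
  | O => match k with O => 1 | S _ => 0 end
  | S m' => a * pasc a m' k + match k with O => 0 | S k' => pasc a m' k' end
  end.

Definition pasc_prev (a : R) (m k : nat) : R :=
  match k with O => 0 | S k' => pasc a m k' end.

Lemma pasc_succ a m k : pasc a (S m) k = a * pasc a m k + pasc_prev a m k.
Proof. reflexivity. Qed.

Lemma pasc_gt a m : forall k, (m < k)%nat -> pasc a m k = 0.
Proof.
  induction m as [|m IH]; intros [|k] Hk; try lia; [reflexivity|].
  rewrite pasc_succ. unfold pasc_prev. rewrite !IH by lia. ring.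
Qed.

Lemma pasc_diag a m : pasc a m m = 1.
Proof.
  induction m as [|m IH]; [reflexivity|].
  rewrite pasc_succ, pasc_gt by lia. unfold pasc_prev. rewrite IH. ring.
Qed.

Lemma pasc_nonneg a m : 0 <= a -> forall k, 0 <= pasc a m k.
Proof.
  intros Ha. induction m as [|m IH]; intros k; [destruct k; simpl; lra|].
  rewrite pasc_succ. specialize (IH k) as H1.
  destruct k as [|k]; unfold pasc_prev; [nra|]. specialize (IH k). nra.
Qed.

Lemma pasc_0 m : forall k, m <> k -> pasc 0 m k = 0.
Proof.
  induction m as [|m IH]; intros [|k] Hk; try lia; try reflexivity;
    rewrite pasc_succ; unfold pasc_prev; [ring|].
  rewrite (IH k) by lia. ring.
Qed.

(** The identity [(a + z) f' = m f] for [f = (a + z)^m]. *)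
Lemma pasc_euler a m : forall k,
  INR m * pasc a m k = INR k * pasc a m k + (INR k + 1) * a * pasc a m (S k).
Proof.
  induction m as [|m IH]; intros k.
  - destruct k; simpl; ring.
  - rewrite !pasc_succ. unfold pasc_prev. destruct k as [|k].
    + specialize (IH 0%nat). rewrite S_INR in *. change (INR 0) with 0 in *.
      transitivity (a * (INR m * pasc a m 0) + a * pasc a m 0); [ring|]. rewrite IH. ring.
    + assert (H1 := IH (S k)). assert (H2 := IH k). rewrite !S_INR in *.
      transitivity (a * (INR m * pasc a m (S k)) + INR m * pasc a m k
                    + a * pasc a m (S k) + pasc a m k); [ring|].
      rewrite H1, H2. ring.
Qed.

(** The identity [f' = m (a + z)^(m-1)]. *)
Lemma pasc_pred a m k : INR m * pasc a (pred m) k = (INR k + 1) * pasc a m (S k).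
Proof.
  destruct m as [|m]; [simpl; ring|]. simpl (pred (S m)).
  rewrite pasc_succ. unfold pasc_prev. rewrite S_INR.
  transitivity (INR m * pasc a m k + pasc a m k); [ring|]. rewrite pasc_euler. ring.
Qed.

Lemma pasc_binomial a b m : sum_n (fun k => pasc a m k * b ^ k) m = (a + b) ^ m.
Proof.
  induction m as [|m IH].
  - rewrite sum_O. simpl. ring.
  - assert (E : forall M, sum_n (fun k => pasc a (S m) k * b ^ k) (S M)
               = a * sum_n (fun k => pasc a m k * b ^ k) (S M)
                 + b * sum_n (fun k => pasc a m k * b ^ k) M).
    { induction M as [|M IHM].
      - rewrite !sum_succ, !sum_O, !pasc_succ. simpl. ring.
      - rewrite sum_succ, IHM, (sum_succ _ (S M)), (sum_succ _ M), pasc_succ.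
        simpl. ring. }
    rewrite E, sum_succ, (pasc_gt a m (S m)), IH by lia. simpl. ring.
Qed.

Lemma is_derive_affine (f g : R -> R) a f' g' : is_derive f a f' -> is_derive g a g' ->
  is_derive (fun a => a * f a + g a) a (f a + a * f' + g').
Proof.
  intros Hf Hg. auto_derive.
  - split; [now exists f'|split; [now exists g'|exact I]].
  - replace (Derive (fun x : R => f x) a) with f' by (symmetry; apply is_derive_unique, Hf).
    replace (Derive (fun x : R => g x) a) with g' by (symmetry; apply is_derive_unique, Hg).
    ring.
Qed.

Lemma is_derive_pasc m : forall k a,
  is_derive (fun a => pasc a m k) a ((INR k + 1) * pasc a m (S k)).
Proof.
  induction m as [|m IH]; intros k a.
  - replace ((INR k + 1) * pasc a 0 (S k)) with 0 by (simpl; ring).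
    destruct k; simpl; auto_derive; easy.
  - assert (Hp : is_derive (fun a => pasc_prev a m k) a (INR k * pasc a m k)).
    { destruct k as [|k]; unfold pasc_prev.
      - simpl INR. rewrite Rmult_0_l. auto_derive; easy.
      - rewrite S_INR. apply IH. }
    assert (H := is_derive_affine _ _ _ _ _ (IH k a) Hp).
    replace ((INR k + 1) * pasc a (S m) (S k)) with
      (pasc a m k + a * ((INR k + 1) * pasc a m (S k)) + INR k * pasc a m k); [exact H|].
    rewrite pasc_succ. unfold pasc_prev. ring.
Qed.

(** The birth and death generator maps the basis [pasc a _ k] to combinations
    of its neighbours. *)
Lemma pasc_generator alpha a m k :
  INR m * pasc a (pred m) k - (2 * INR m + 1 + alpha) * pasc a m k
    + (INR m + 1 + alpha) * pasc a (S m) k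
  = (INR k + 1) * (1 - a) ^ 2 * pasc a m (S k)
    - (2 * INR k + 1 + alpha) * (1 - a) * pasc a m k
    + (INR k + alpha) * pasc_prev a m k.
Proof.
  rewrite pasc_pred, pasc_succ. assert (H := pasc_euler a m k).
  assert (H' : INR m * pasc_prev a m k = (INR k - 1) * pasc_prev a m k + INR k * a * pasc a m k).
  { destruct k as [|k]; unfold pasc_prev; [simpl; ring|].
    rewrite S_INR, pasc_euler. ring. }
  transitivity ((INR k + 1) * pasc a m (S k) + (a - 2) * (INR m * pasc a m k)
    - (1 + alpha) * (1 - a) * pasc a m k + INR m * pasc_prev a m k
    + (1 + alpha) * pasc_prev a m k); [ring|].
  rewrite H, H'. ring.
Qed.

(** The reversible measure [(alpha + 1)_k / k!] of the birth and death process
    with birth rates [n + 1 + alpha] and death rates [n]. *)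
Fixpoint wgt (alpha : R) (k : nat) : R :=
  match k with
  | O => 1
  | S j => wgt alpha j * ((INR j + 1 + alpha) / (INR j + 1))
  end.

Lemma rate_pos alpha j : -1 < alpha -> 0 < INR j + 1 + alpha.
Proof. intros. assert (H0 := pos_INR j). lra. Qed.

Lemma wgt_pos alpha k : -1 < alpha -> 0 < wgt alpha k.
Proof.
  intros Ha. induction k as [|k IH]; simpl; [lra|].
  assert (H0 := pos_INR k). apply Rmult_lt_0_compat; [assumption|].
  apply Rdiv_lt_0_compat; [now apply rate_pos|lra].
Qed.

Lemma wgt_succ alpha k : (INR k + 1) * wgt alpha (S k) = (INR k + 1 + alpha) * wgt alpha k.
Proof. simpl. assert (H0 := pos_INR k). field. lra. Qed.

Definition mix (alpha t : R) (k : nat) : R :=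
  / wgt alpha k * (/ (1 + t)) ^ (2 * k) * Rpower (1 + t) (- (alpha + 1)).

Lemma mix_pos alpha t k : -1 < alpha -> -1 < t -> 0 < mix alpha t k.
Proof.
  intros Ha Ht. unfold mix. repeat apply Rmult_lt_0_compat.
  - apply Rinv_0_lt_compat. now apply wgt_pos.
  - apply pow_lt, Rinv_0_lt_compat. lra.
  - apply exp_pos.
Qed.

(** Detailed balance for the number of surviving lines of descent. *)
Lemma mix_succ alpha t k : -1 < alpha -> -1 < t ->
  (INR k + 1 + alpha) * mix alpha t (S k) = (INR k + 1) * (/ (1 + t)) ^ 2 * mix alpha t k.
Proof.
  intros Ha Ht. unfold mix. simpl wgt.
  replace (2 * S k)%nat with (2 * k + 2)%nat by lia. rewrite pow_add.
  assert (H0 := pos_INR k). assert (H1 := wgt_pos alpha k Ha). assert (H2 := rate_pos alpha k Ha).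
  field. lra.
Qed.

Lemma mix_Rpower alpha t k : -1 < t ->
  mix alpha t k = / wgt alpha k * Rpower (1 + t) (- (2 * INR k + 1 + alpha)).
Proof.
  intros Ht. unfold mix. rewrite pow_inv, <- Rpower_pow, <- Rpower_Ropp by lra.
  rewrite Rmult_assoc, <- Rpower_plus, mult_INR. do 2 f_equal. simpl. ring.
Qed.

Lemma is_derive_mix alpha t k : -1 < alpha -> -1 < t ->
  is_derive (fun t => mix alpha t k) t (- (2 * INR k + 1 + alpha) * / (1 + t) * mix alpha t k).
Proof.
  intros Ha Ht. rewrite mix_Rpower by assumption.
  apply (is_derive_ext_loc
    (fun t => / wgt alpha k * Rpower (1 + t) (- (2 * INR k + 1 + alpha)))).
  - assert (Hp : 0 < 1 + t) by lra. exists (mkposreal _ Hp). intros s Hs.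
    symmetry. apply mix_Rpower.
    unfold ball in Hs; simpl in Hs; unfold AbsRing_ball, abs, minus, plus, opp in Hs; simpl in Hs.
    apply Rabs_def2 in Hs. lra.
  - unfold Rpower. auto_derive; [lra|]. field. split; [|lra].
    assert (H := wgt_pos alpha k Ha). lra.
Qed.

(** Transition density, with respect to [wgt], of the birth and death process
    started from [m] individuals. With [a = t / (1 + t)], each of them has
    living descendants at time [t] with probability [1 - a], independently;
    given that [k] of them do, the population is [k] plus a negative binomial
    variable of parameter [k + 1 + alpha]. *)
Definition dens (alpha t : R) (m n : nat) : R :=
  sum_n (fun k => pasc (t / (1 + t)) m k * pasc (t / (1 + t)) n k * mix alpha t k) m.

Lemma dens_sum alpha t m n M : (m <= M)%nat ->
  dens alpha t m n =
  sum_n (fun k => pasc (t / (1 + t)) m k * pasc (t / (1 + t)) n k * mix alpha t k) M.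
Proof.
  intros H. symmetry. apply sum_eventually_zero; [|assumption].
  intros k Hk. rewrite (pasc_gt _ m) by assumption. ring.
Qed.

Lemma dens_sym alpha t m n : dens alpha t m n = dens alpha t n m.
Proof.
  rewrite (dens_sum _ _ m n (m + n)), (dens_sum _ _ n m (m + n)) by lia.
  apply sum_ext_le. intros k _. ring.
Qed.

Lemma shift_pos t : 0 <= t -> 0 <= t / (1 + t) < 1.
Proof.
  intros Ht. split.
  - apply Rmult_le_pos; [assumption|]. left. apply Rinv_0_lt_compat. lra.
  - apply (Rmult_lt_reg_r (1 + t)); [lra|]. unfold Rdiv. rewrite Rmult_assoc, Rinv_l by lra. lra.
Qed.

Lemma dens_nonneg alpha t m n : -1 < alpha -> 0 <= t -> 0 <= dens alpha t m n.
Proof.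
  intros Ha Ht. apply sum_nonneg. intros k. destruct (shift_pos t Ht) as [H _].
  apply Rmult_le_pos; [apply Rmult_le_pos; now apply pasc_nonneg|].
  left. apply mix_pos; lra.
Qed.

Lemma dens_0 alpha m n : -1 < alpha ->
  dens alpha 0 m n = if Nat.eqb m n then / wgt alpha m else 0.
Proof.
  intros Ha. unfold dens. replace (0 / (1 + 0)) with 0 by field.
  assert (Hz : forall k, m <> k \/ n <> k -> pasc 0 m k * pasc 0 n k * mix alpha 0 k = 0).
  { intros k [H|H]; rewrite (pasc_0 _ _ H); ring. }
  assert (Hd : pasc 0 m m * pasc 0 m m * mix alpha 0 m = / wgt alpha m).
  { unfold mix, Rpower. rewrite pasc_diag, Rplus_0_r, ln_1, Rmult_0_r, exp_0, Rinv_1, pow1. ring. }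
  assert (Hs : sum_n (fun k => pasc 0 m k * pasc 0 n k * mix alpha 0 k) m
               = pasc 0 m m * pasc 0 n m * mix alpha 0 m).
  { apply sum_last. intros k Hk. apply Hz. lia. }
  rewrite Hs. destruct (Nat.eqb_spec m n) as [<-|H]; [assumption|].
  apply Hz. lia.
Qed.

Lemma is_derive_odds t : -1 < t -> is_derive (fun t => t / (1 + t)) t ((/ (1 + t)) ^ 2).
Proof. intros Ht. auto_derive; [lra|]. field. lra. Qed.

Lemma is_derive_pasc_odds t m k : -1 < t ->
  is_derive (fun t => pasc (t / (1 + t)) m k) t
    ((/ (1 + t)) ^ 2 * ((INR k + 1) * pasc (t / (1 + t)) m (S k))).
Proof.
  intros Ht. apply (is_derive_comp (fun a => pasc a m k) (fun t => t / (1 + t))).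
  - apply is_derive_pasc.
  - now apply is_derive_odds.
Qed.

(** Backward equation. Differentiating the survivor expansion produces, up to
    a shift of the summation index, the action of the generator on its terms. *)
Lemma is_derive_dens alpha t m n : -1 < alpha -> -1 < t ->
  is_derive (fun t => dens alpha t m n) t
    (INR m * dens alpha t (pred m) n - (2 * INR m + 1 + alpha) * dens alpha t m n
     + (INR m + 1 + alpha) * dens alpha t (S m) n).
Proof.
  intros Ha Ht.
  set (A := fun j k => pasc (t / (1 + t)) j k). set (D := mix alpha t). set (b := / (1 + t)).
  set (f := fun k => b ^ 2 * ((INR k + 1) * A m (S k)) * A n k * D k
                   + A m k * (b ^ 2 * ((INR k + 1) * A n (S k))) * D k
                   + A m k * A n k * (- (2 * INR k + 1 + alpha) * b * D k)).
  assert (E : INR m * dens alpha t (pred m) n - (2 * INR m + 1 + alpha) * dens alpha t m n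
     + (INR m + 1 + alpha) * dens alpha t (S m) n = sum_n f (S m)).
  { rewrite (dens_sum _ _ (pred m) n (S m)), (dens_sum _ _ m n (S m)),
      (dens_sum _ _ (S m) n (S m)) by lia.
    unfold Rminus. rewrite (Ropp_mult_distr_l (2 * INR m + 1 + alpha)).
    rewrite <- !sum_scal, <- !sum_add.
    set (g := fun k => D k * A n k * ((INR k + 1) * b ^ 2 * A m (S k)
        - (2 * INR k + 1 + alpha) * b * A m k
        + (INR k + alpha) * pasc_prev (t / (1 + t)) m k)).
    transitivity (sum_n g (S m)).
    - apply sum_ext_le. intros k _. unfold g, A, D, b.
      replace (/ (1 + t)) with (1 - t / (1 + t)) by (field; lra).
      rewrite <- pasc_generator. ring.
    - (* Summation by parts: [mix_succ] matches the [k]-th term of one sum with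
         the [k + 1]-st term of the other. *)
      assert (T : forall M, sum_n f M - sum_n g M
                  = A m M * (b ^ 2 * ((INR M + 1) * A n (S M))) * D M).
      { induction M as [|M IH].
        - rewrite !sum_O. unfold f, g, pasc_prev. simpl INR. ring.
        - rewrite !sum_succ.
          replace (sum_n f M + f (S M) - (sum_n g M + g (S M)))
            with (sum_n f M - sum_n g M + f (S M) - g (S M)) by ring.
          rewrite IH.
          assert (Hm := mix_succ alpha t M Ha Ht). fold D b in Hm.
          replace (A m M * (b ^ 2 * ((INR M + 1) * A n (S M))) * D M)
            with (A m M * A n (S M) * ((INR M + 1) * b ^ 2 * D M)) by ring.
          rewrite <- Hm. unfold f, g, pasc_prev. fold (A m M). rewrite S_INR. ring. }
      specialize (T (S m)). unfold A at 1 in T. rewrite (pasc_gt _ m (S m)) in T by lia. lra. }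
  rewrite E.
  apply (is_derive_ext (fun t => sum_n (fun k =>
    pasc (t / (1 + t)) m k * pasc (t / (1 + t)) n k * mix alpha t k) (S m))).
  { intros s. symmetry. apply dens_sum. lia. }
  apply (is_derive_sum_n (V := R_NormedModule) (fun k t =>
    pasc (t / (1 + t)) m k * pasc (t / (1 + t)) n k * mix alpha t k)).
  intros k _.
  assert (H1 := is_derive_pasc_odds t m k Ht). assert (H2 := is_derive_pasc_odds t n k Ht).
  assert (H3 := is_derive_mix alpha t k Ha Ht).
  assert (H12 := is_derive_mult _ _ t _ _ H1 H2 Rmult_comm).
  assert (H := is_derive_mult _ _ t _ _ H12 H3 Rmult_comm).
  eapply is_derive_ext; [|eapply (eq_ind _ (is_derive _ t) H)].
  - reflexivity.
  - unfold f, A, D, b, plus, mult. simpl. ring.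
Qed.


(** The negative binomial series bounds its partial sums: multiplied by the
    reciprocal of the full sum, a partial sum decreases in [a]. *)
Lemma negative_binomial_le alpha a k N : -1 < alpha -> 0 <= a < 1 ->
  Rpower (1 - a) (INR k + 1 + alpha) * sum_n (fun n => wgt alpha n * pasc a n k) N
  <= wgt alpha k.
Proof.
  intros Ha Ha1. set (F := fun x => sum_n (fun n => wgt alpha n * pasc x n k) N).
  set (F' := fun x => sum_n (fun n => wgt alpha n * ((INR k + 1) * pasc x n (S k))) N).
  set (be := INR k + 1 + alpha).
  assert (Hbe : 0 < be) by now apply rate_pos.
  assert (DF : forall x, is_derive F x (F' x)).
  { intros x. apply (is_derive_sum_n (V := R_NormedModule) (fun n x => wgt alpha n * pasc x n k)).
    intros n _. apply is_derive_scal, is_derive_pasc. }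
  (* The summands telescope, since [wgt] is reversible. *)
  assert (HF : forall x, (1 - x) * F' x - be * F x
            = - (wgt alpha N * (INR N + 1 + alpha) * pasc x N k)).
  { intros x. unfold F, F', be. clear. induction N as [|N IH].
    - rewrite !sum_O. assert (E := pasc_euler x 0 k). assert (P := pasc_pred x 0 k).
      simpl INR in *. simpl (pred 0) in P.
      transitivity (wgt alpha 0 * ((INR k + 1) * pasc x 0 (S k) - (INR k + 1) * x * pasc x 0 (S k)
        - (INR k + 1 + alpha) * pasc x 0 k)); [ring|].
      rewrite <- P.
      replace ((INR k + 1) * x * pasc x 0 (S k)) with (- INR k * pasc x 0 k) by lra. ring.
    - rewrite !sum_succ. assert (E := pasc_euler x (S N) k). assert (P := pasc_pred x (S N) k).
      simpl (pred (S N)) in P. rewrite S_INR in *.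
      transitivity ((1 - x) * sum_n (fun n => wgt alpha n * ((INR k + 1) * pasc x n (S k))) N
        - (INR k + 1 + alpha) * sum_n (fun n => wgt alpha n * pasc x n k) N
        + wgt alpha (S N) * ((INR k + 1) * pasc x (S N) (S k)
          - (INR k + 1) * x * pasc x (S N) (S k)
          - (INR k + 1 + alpha) * pasc x (S N) k)); [ring|].
      rewrite IH, <- P.
      replace ((INR k + 1) * x * pasc x (S N) (S k))
        with ((INR N + 1) * pasc x (S N) k - INR k * pasc x (S N) k) by lra.
      replace (wgt alpha (S N) * ((INR N + 1) * pasc x N k -
        ((INR N + 1) * pasc x (S N) k - INR k * pasc x (S N) k) - (INR k + 1 + alpha) * pasc x (S N) k))
      with ((INR N + 1) * wgt alpha (S N) * pasc x N k
            - wgt alpha (S N) * (INR N + 1 + 1 + alpha) * pasc x (S N) k) by ring.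
      rewrite wgt_succ. ring. }
  set (h := fun x => Rpower (1 - x) be * F x).
  set (h' := fun x => Rpower (1 - x) be * / (1 - x) * ((1 - x) * F' x - be * F x)).
  destruct (mean_value 0 a h h') as [c [Hc E]]; [lra| |].
  - intros s Hs. apply is_derive_within.
    assert (DR : is_derive (fun x => Rpower (1 - x) be) s (- be * / (1 - s) * Rpower (1 - s) be)).
    { unfold Rpower. auto_derive; [lra|]. unfold Rminus. field. lra. }
    assert (H := is_derive_mult _ _ s _ _ DR (DF s) Rmult_comm).
    eapply is_derive_ext; [|eapply (eq_ind _ (is_derive _ s) H)]; [reflexivity|].
    unfold h', plus, mult. simpl. field. lra.
  - assert (Hh' : h' c <= 0).
    { unfold h'. rewrite HF.
      assert (H1 := exp_pos (be * ln (1 - c))). fold (Rpower (1 - c) be) in H1.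
      assert (H2 : 0 < / (1 - c)) by (apply Rinv_0_lt_compat; lra).
      assert (H3 := wgt_pos alpha N Ha). assert (H4 := rate_pos alpha N Ha).
      assert (H5 := pasc_nonneg c N (proj1 Hc) k).
      assert (0 <= wgt alpha N * (INR N + 1 + alpha) * pasc c N k).
      { apply Rmult_le_pos; [|assumption]. left. now apply Rmult_lt_0_compat. }
      assert (0 < Rpower (1 - c) be * / (1 - c)) by now apply Rmult_lt_0_compat.
      nra. }
    assert (H0 : h 0 <= wgt alpha k).
    { unfold h, F. replace (1 - 0) with 1 by ring.
      assert (Rpower 1 be = 1) by (unfold Rpower; rewrite ln_1, Rmult_0_r, exp_0; reflexivity).
      rewrite H, Rmult_1_l.
      rewrite <- (Rmult_1_r (wgt alpha k)), <- (pasc_diag 0 k).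
      assert (Hw := wgt_pos alpha k Ha).
      destruct (Nat.lt_ge_cases N k) as [HNk|HNk].
      - rewrite (sum_ext_le _ (fun _ => 0)).
        + rewrite sum_n_const, pasc_diag. lra.
        + intros n Hn. rewrite pasc_0 by lia. ring.
      - rewrite (sum_eventually_zero _ k); [|intros n Hn; rewrite pasc_0 by lia; ring|lia].
        rewrite sum_last; [lra|]. intros n Hn. rewrite pasc_0 by lia. ring. }
    change (h a <= wgt alpha k). nra.
Qed.

Lemma dens_row_sum alpha t m N : -1 < alpha -> 0 <= t ->
  sum_n (fun n => dens alpha t m n * wgt alpha n) N <= 1.
Proof.
  intros Ha Ht. destruct (shift_pos t Ht) as [Hs1 Hs2]. set (a := t / (1 + t)) in *.
  assert (Hb : 1 - a = / (1 + t)) by (unfold a; field; lra).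
  assert (Hb0 : 0 < / (1 + t)) by (apply Rinv_0_lt_compat; lra).
  replace 1 with ((a + / (1 + t)) ^ m)
    by (rewrite <- Hb; replace (a + (1 - a)) with 1 by ring; apply pow1).
  rewrite <- pasc_binomial. unfold dens. fold a.
  rewrite (sum_ext_le _ (fun n => sum_n (fun k =>
    pasc a m k * mix alpha t k * (wgt alpha n * pasc a n k)) m)).
  2: { intros n _. rewrite Rmult_comm, <- sum_scal. apply sum_ext_le. intros k _. ring. }
  rewrite (sum_n_switch (G := R_AbelianMonoid)). apply sum_le. intros k _.
  rewrite sum_scal. set (F := sum_n _ N).
  rewrite Rmult_assoc. apply Rmult_le_compat_l; [now apply pasc_nonneg|].
  assert (HN := negative_binomial_le alpha a k N Ha (conj Hs1 Hs2)). fold F in HN.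
  rewrite Hb in HN.
  assert (Hw := wgt_pos alpha k Ha).
  rewrite mix_Rpower by lra.
  assert (ER : Rpower (/ (1 + t)) (INR k + 1 + alpha) = Rpower (1 + t) (- (INR k + 1 + alpha))).
  { unfold Rpower. rewrite ln_Rinv by lra. f_equal. ring. }
  rewrite ER in HN.
  assert (EP : Rpower (1 + t) (- (2 * INR k + 1 + alpha))
             = (/ (1 + t)) ^ k * Rpower (1 + t) (- (INR k + 1 + alpha))).
  { rewrite pow_inv, <- Rpower_pow, <- Rpower_Ropp, <- Rpower_plus by lra. f_equal. ring. }
  rewrite EP.
  assert (Hbk : 0 < (/ (1 + t)) ^ k) by now apply pow_lt.
  replace (/ wgt alpha k * ((/ (1 + t)) ^ k * Rpower (1 + t) (- (INR k + 1 + alpha))) * F)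
    with ((/ (1 + t)) ^ k * (/ wgt alpha k * (Rpower (1 + t) (- (INR k + 1 + alpha)) * F))) by ring.
  rewrite <- (Rmult_1_r ((/ (1 + t)) ^ k)) at 2. apply Rmult_le_compat_l; [lra|].
  apply (Rmult_le_reg_l (wgt alpha k)); [assumption|].
  rewrite <- Rmult_assoc, Rinv_r by lra. lra.
Qed.

Definition heat (alpha t : R) (m n : nat) : R :=
  sqrt (wgt alpha m) * sqrt (wgt alpha n) * dens alpha t m n.

Lemma heat_sym alpha t m n : heat alpha t m n = heat alpha t n m.
Proof. unfold heat. rewrite dens_sym. ring. Qed.

Lemma heat_nonneg alpha t m n : -1 < alpha -> 0 <= t -> 0 <= heat alpha t m n.
Proof.
  intros. apply Rmult_le_pos; [|now apply dens_nonneg].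
  apply Rmult_le_pos; apply sqrt_pos.
Qed.

Lemma heat_0 alpha m n : -1 < alpha -> heat alpha 0 m n = if Nat.eqb m n then 1 else 0.
Proof.
  intros Ha. unfold heat. rewrite dens_0 by assumption.
  destruct (Nat.eqb_spec m n) as [<-|_]; [|ring].
  assert (Hw := wgt_pos alpha m Ha). rewrite sqrt_sqrt by lra. field. lra.
Qed.

(** The square root of [wgt] is excessive for the kernel, because transition
    probabilities sum to at most one. *)
Lemma heat_row_sum alpha t m N : -1 < alpha -> 0 <= t ->
  sum_n (fun n => heat alpha t m n * sqrt (wgt alpha n)) N <= sqrt (wgt alpha m).
Proof.
  intros Ha Ht.
  rewrite (sum_ext_le _ (fun n => sqrt (wgt alpha m) * (dens alpha t m n * wgt alpha n))).
  - rewrite sum_scal. assert (H := dens_row_sum alpha t m N Ha Ht).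
    assert (H0 := sqrt_pos (wgt alpha m)). nra.
  - intros n _. unfold heat. rewrite <- (sqrt_sqrt (wgt alpha n)) at 3.
    + ring.
    + left. now apply wgt_pos.
Qed.

Lemma offdiag_up alpha n : -1 < alpha ->
  offdiag alpha n * sqrt (wgt alpha (S n)) = (INR n + 1 + alpha) * sqrt (wgt alpha n).
Proof.
  intros Ha. assert (H1 := rate_pos alpha n Ha). assert (H0 := pos_INR n).
  assert (H2 := wgt_pos alpha n Ha).
  unfold offdiag. rewrite <- sqrt_mult_alt by nra.
  rewrite <- (sqrt_square (INR n + 1 + alpha)) at 2 by lra.
  rewrite <- sqrt_mult_alt by nra. f_equal.
  replace ((INR n + 1) * (INR n + 1 + alpha) * wgt alpha (S n))
    with ((INR n + 1 + alpha) * ((INR n + 1) * wgt alpha (S n))) by ring.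
  rewrite wgt_succ. ring.
Qed.

Lemma offdiag_down alpha n : -1 < alpha ->
  offdiag alpha n * sqrt (wgt alpha n) = (INR n + 1) * sqrt (wgt alpha (S n)).
Proof.
  intros Ha. assert (H1 := rate_pos alpha n Ha). assert (H0 := pos_INR n).
  unfold offdiag. rewrite <- sqrt_mult_alt by nra.
  rewrite <- (sqrt_square (INR n + 1)) at 3 by lra.
  rewrite <- sqrt_mult_alt by nra. f_equal.
  transitivity ((INR n + 1) * ((INR n + 1 + alpha) * wgt alpha n)); [ring|].
  rewrite <- wgt_succ. ring.
Qed.

Definition heat_dt (alpha t : R) (n m : nat) : R :=
  sqrt (wgt alpha n) * sqrt (wgt alpha m) *
  (INR m * dens alpha t (pred m) n - (2 * INR m + 1 + alpha) * dens alpha t m n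
     + (INR m + 1 + alpha) * dens alpha t (S m) n).

Lemma is_derive_heat alpha t n m : -1 < alpha -> -1 < t ->
  is_derive (fun t => heat alpha t n m) t (heat_dt alpha t n m).
Proof.
  intros Ha Ht. apply (is_derive_ext (fun t => sqrt (wgt alpha n) * sqrt (wgt alpha m) * dens alpha t m n)).
  - intros s. unfold heat. now rewrite (dens_sym _ s m n).
  - apply is_derive_scal. now apply is_derive_dens.
Qed.

(** The backward and the forward equation agree, the kernel being symmetric. *)
Lemma heat_dt_sym alpha t n m : -1 < alpha -> -1 < t ->
  heat_dt alpha t n m = heat_dt alpha t m n.
Proof.
  intros Ha Ht. rewrite <- (is_derive_unique _ _ _ (is_derive_heat alpha t n m Ha Ht)).
  apply is_derive_unique. apply (is_derive_ext (fun t => heat alpha t m n)).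
  - intros s. apply heat_sym.
  - now apply is_derive_heat.
Qed.

(** A row of the kernel, scaled by a test vector [c] of the plane; by symmetry
    of the kernel it is also the flow of [c] times a unit vector. *)
Definition hrow (alpha : R) (c : C) (t : R) (n : nat) : cseq :=
  fun m => (c * RtoC (heat alpha t n m))%C.

Lemma tau_hrow alpha c t n m : -1 < alpha ->
  tau alpha (hrow alpha c t n) m = (c * RtoC (- heat_dt alpha t n m))%C.
Proof.
  intros Ha. unfold tau, hrow.
  assert (E : - heat_dt alpha t n m =
    - (sqrt (INR m * (INR m + alpha)) * match m with O => 0 | S k => heat alpha t n k end)
    + (2 * INR m + 1 + alpha) * heat alpha t n m - offdiag alpha m * heat alpha t n (S m)).
  { unfold heat_dt, heat. rewrite !(dens_sym alpha t n).
    assert (E1 : offdiag alpha m * (sqrt (wgt alpha n) * sqrt (wgt alpha (S m)) * dens alpha t (S m) n)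
      = sqrt (wgt alpha n) * sqrt (wgt alpha m) * ((INR m + 1 + alpha) * dens alpha t (S m) n)).
    { transitivity (offdiag alpha m * sqrt (wgt alpha (S m)) * (sqrt (wgt alpha n) * dens alpha t (S m) n)); [ring|].
      rewrite offdiag_up by assumption. ring. }
    rewrite E1. destruct m as [|m].
    - simpl INR. ring.
    - rewrite S_INR. fold (offdiag alpha m). simpl (pred (S m)).
      rewrite (dens_sym alpha t n m).
      replace (offdiag alpha m * (sqrt (wgt alpha n) * sqrt (wgt alpha m) * dens alpha t m n))
        with (offdiag alpha m * sqrt (wgt alpha m) * (sqrt (wgt alpha n) * dens alpha t m n)) by ring.
      rewrite offdiag_down by assumption. ring. }
  rewrite E. unfold offdiag. destruct m as [|m]; unfold prev.
  - set (x := sqrt _). set (y := sqrt _).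
    apply injective_projections; simpl; ring.
  - set (x := sqrt _). set (y := sqrt _).
    rewrite ?RtoC_minus, ?RtoC_plus, ?RtoC_opp, ?RtoC_mult, ?RtoC_plus.
    apply injective_projections; simpl; ring.
Qed.


(** * The heat semigroup *)

(** The AM-GM form of Schur's test, with the excessive weight
    [sqrt (wgt alpha n)]. *)
Lemma schur_form alpha t (f e : cseq) N M : -1 < alpha -> 0 <= t ->
  sum_n (fun n => sum_n (fun m => heat alpha t n m * dot (f n) (e m)) M) N
  <= / 2 * (sum_n (fun n => dot (f n) (f n)) N + sum_n (fun m => dot (e m) (e m)) M).
Proof.
  intros Ha Ht. set (w := fun n => sqrt (wgt alpha n)).
  assert (Hw : forall n, 0 < w n) by (intros; now apply sqrt_lt_R0, wgt_pos).
  set (h := heat alpha t).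
  assert (Hrow : forall (g : cseq) n K,
    sum_n (fun m => h n m * w m * / w n * dot (g n) (g n)) K <= dot (g n) (g n)).
  { intros g n K. rewrite (sum_ext_le _ (fun m => (/ w n * dot (g n) (g n)) * (h n m * w m))).
    2: { intros m _. ring. }
    rewrite sum_scal. assert (H := heat_row_sum alpha t n K Ha Ht). fold h in H.
    assert (H1 : 0 <= dot (g n) (g n)) by (rewrite <- Cmod_sq; apply pow2_ge_0).
    assert (H2 : 0 < / w n) by now apply Rinv_0_lt_compat.
    apply Rle_trans with (/ w n * dot (g n) (g n) * w n).
    - apply Rmult_le_compat_l; [nra|exact H].
    - right. field. specialize (Hw n). lra. }
  apply Rle_trans with (sum_n (fun n => sum_n (fun m =>
     / 2 * (h n m * w m * / w n * dot (f n) (f n)) + / 2 * (h m n * w n * / w m * dot (e m) (e m))) M) N).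
  - apply sum_le. intros n _. apply sum_le. intros m _.
    assert (Hh : 0 <= h n m) by now apply heat_nonneg.
    unfold h at 3. rewrite heat_sym. fold h.
    assert (H1 := dot_le (f n) (e m)). assert (H2 := Rle_abs (dot (f n) (e m))).
    rewrite <- !Cmod_sq. set (x := Cmod (f n)) in *. set (y := Cmod (e m)) in *.
    assert (H3 : dot (f n) (e m) <= / 2 * (w m * / w n * x ^ 2 + w n * / w m * y ^ 2)).
    { assert (Hn := Hw n). assert (Hm := Hw m).
      replace (/ 2 * (w m * / w n * x ^ 2 + w n * / w m * y ^ 2))
        with (/ 2 * (w m * / w n) * (x - w n * / w m * y) ^ 2 + x * y) by (field; lra).
      assert (0 < w m * / w n) by (apply Rmult_lt_0_compat; [|apply Rinv_0_lt_compat]; lra).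
      assert (0 <= (x - w n * / w m * y) ^ 2) by apply pow2_ge_0. nra. }
    fold (h n m). apply (Rmult_le_compat_l (h n m)) in H3; [|assumption].
    eapply Rle_trans; [exact H3|]. right. ring.
  - rewrite (sum_ext_le _ (fun n => / 2 * sum_n (fun m => h n m * w m * / w n * dot (f n) (f n)) M
              + / 2 * sum_n (fun m => h m n * w n * / w m * dot (e m) (e m)) M)).
    2: { intros n _. now rewrite sum_add, !sum_scal. }
    rewrite sum_add, !sum_scal, Rmult_plus_distr_l. apply Rplus_le_compat.
    + apply Rmult_le_compat_l; [lra|]. apply sum_le. intros n _. apply Hrow.
    + apply Rmult_le_compat_l; [lra|].
      rewrite (sum_n_switch (G := R_AbelianMonoid)). apply sum_le. intros m _. apply Hrow.
Qed.

Lemma hrow_scal alpha c t n : hrow alpha c t n = seq_scal c (hrow alpha (RtoC 1) t n).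
Proof. unfold hrow. seq_eq. Qed.

Lemma in_l2_hrow alpha c t n : -1 < alpha -> 0 <= t -> in_l2 (hrow alpha c t n).
Proof.
  intros Ha Ht. rewrite hrow_scal. apply in_l2_scal.
  set (e := hrow alpha (RtoC 1) t n).
  (* Schur's form of a unit vector and of the row itself is the squared norm of the row. *)
  apply (ex_series_bounded _ 1); [intros; apply pow2_ge_0|]. intros M.
  assert (H := schur_form alpha t (delta (RtoC 1) n) e n M Ha Ht).
  assert (Hd : forall k, (k < n)%nat -> delta (RtoC 1) n k = RtoC 0).
  { intros k Hk. unfold delta. now rewrite (proj2 (Nat.eqb_neq k n)) by lia. }
  assert (Hn : delta (RtoC 1) n n = RtoC 1) by (unfold delta; now rewrite Nat.eqb_refl).
  rewrite (sum_last (fun k => dot (delta (RtoC 1) n k) (delta (RtoC 1) n k)) n) in H.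
  2: { intros k Hk. rewrite Hd by assumption. unfold dot. simpl. ring. }
  rewrite (sum_last (fun k => sum_n _ M) n) in H.
  2: { intros k Hk. rewrite Hd by assumption. rewrite (sum_ext_le _ (fun _ => 0)).
       - rewrite sum_n_const. ring.
       - intros m _. unfold dot. simpl. ring. }
  rewrite Hn, (sum_ext_le _ (fun m => dot (e m) (e m))) in H.
  2: { intros m _. unfold e, hrow, dot. simpl. ring. }
  rewrite (sum_ext_le _ (fun m => dot (e m) (e m))) by (intros; apply Cmod_sq).
  replace (dot (RtoC 1) (RtoC 1)) with 1 in H by (unfold dot; simpl; ring). lra.
Qed.

(** The two components are the pairings with the row times [1] and times [i],
    so that the whole entry is tested through inner products ([dot_flow]). *)
Definition flow (alpha t : R) (u : cseq) : cseq := fun n =>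
  (ip u (hrow alpha (RtoC 1) t n), ip u (hrow alpha Ci t n)).

Section Flow.
Variable alpha : R.
Hypothesis Ha : -1 < alpha.

Lemma dot_flow t u n c : 0 <= t -> in_l2 u -> dot (flow alpha t u n) c = ip u (hrow alpha c t n).
Proof.
  intros Ht Hu.
  replace (hrow alpha c t n) with (seq_plus (seq_scal (RtoC (Re c)) (hrow alpha (RtoC 1) t n))
     (seq_scal (RtoC (Im c)) (hrow alpha Ci t n))).
  - rewrite ip_plus_r, !ip_scal_r by (auto using in_l2_hrow with l2).
    unfold dot, flow. simpl. ring.
  - unfold hrow. seq_eq.
Qed.

Lemma flow_delta t c n : flow alpha t (delta c n) = hrow alpha c t n.
Proof.
  apply functional_extensionality. intros m. unfold flow. rewrite !ip_delta.
  unfold hrow. rewrite (heat_sym alpha t m n).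
  apply injective_projections; unfold dot, Re, Im; simpl; ring.
Qed.

Lemma sum_Series (F : nat -> nat -> R) N : (forall n, ex_series (F n)) ->
  ex_series (fun m => sum_n (fun n => F n m) N) /\
  sum_n (fun n => Series (F n)) N = Series (fun m => sum_n (fun n => F n m) N).
Proof.
  intros H. induction N as [|N [IH1 IH2]].
  - rewrite sum_O. split.
    + apply (ex_series_ext (F 0%nat)); [|apply H]. intros m. now rewrite sum_O.
    + apply Series_ext. intros m. now rewrite sum_O.
  - assert (E : forall m, sum_n (fun n => F n m) N + F (S N) m = sum_n (fun n => F n m) (S N)).
    { intros m. now rewrite sum_succ. }
    split.
    + apply (ex_series_ext _ _ E). now apply (ex_series_plus (V := R_NormedModule)).
    + rewrite sum_succ, IH2, <- Series_plus by auto. now apply Series_ext.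
Qed.

(** With [f] the flow of [u], the form of [f] and [u] is the squared norm of
    [f], so [schur_form] reads [x <= (x + y) / 2] for the squared norms. *)
Lemma flow_contraction t u : 0 <= t -> in_l2 u ->
  in_l2 (flow alpha t u) /\ l2_norm (flow alpha t u) <= l2_norm u.
Proof.
  intros Ht Hu. set (f := flow alpha t u).
  apply l2_of_trunc; [apply l2_norm_pos|]. intros N.
  apply norm_le_of_sq; [auto with l2|apply l2_norm_pos|].
  rewrite <- l2_norm_sq, trunc_norm_sq by auto with l2.
  assert (Hex : forall n, ex_series (fun m => dot (u m) (hrow alpha (f n) t n m))).
  { intros n. apply ex_dot; [assumption|now apply in_l2_hrow]. }
  destruct (sum_Series (fun n m => dot (u m) (hrow alpha (f n) t n m)) N Hex) as [E1 E2].
  assert (E : sum_n (fun n => dot (f n) (f n)) N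
    = Series (fun m => sum_n (fun n => dot (u m) (hrow alpha (f n) t n m)) N)).
  { rewrite <- E2. apply sum_ext_le. intros n _. now apply dot_flow. }
  set (x := sum_n (fun n => dot (f n) (f n)) N) in *.
  assert (B : x <= / 2 * (x + l2_norm u ^ 2)); [|lra].
  rewrite E at 1. apply Series_le_bound; [assumption|]. intros M.
  rewrite (sum_n_switch (G := R_AbelianMonoid)).
  eapply Rle_trans; [|apply (Rmult_le_compat_l (/ 2) (x + sum_n (fun m => dot (u m) (u m)) M))].
  - eapply Rle_trans; [|now apply (schur_form alpha t f u N M)].
    right. apply sum_ext_le. intros n _. apply sum_ext_le. intros m _.
    unfold hrow, dot. simpl. unfold Re, Im. ring.
  - lra.
  - apply Rplus_le_compat_l. rewrite l2_norm_sq by assumption. apply sum_le_Series.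
    + intros n. rewrite <- Cmod_sq. apply pow2_ge_0.
    + now apply ex_dot.
Qed.

Lemma in_l2_flow t u : 0 <= t -> in_l2 u -> in_l2 (flow alpha t u).
Proof. intros. now apply flow_contraction. Qed.
Hint Resolve in_l2_flow : l2.

Lemma flow_0 u : in_l2 u -> flow alpha 0 u = u.
Proof.
  intros Hu. apply functional_extensionality. intros n. apply dot_inj. intros c.
  rewrite dot_flow by (assumption || lra).
  replace (hrow alpha c 0 n) with (delta c n).
  - now rewrite ip_sym, ip_delta, dot_sym.
  - apply functional_extensionality. intros m. unfold delta, hrow. rewrite heat_0, Nat.eqb_sym by assumption.
    destruct (Nat.eqb n m); ring.
Qed.

Lemma flow_plus t u v : 0 <= t -> in_l2 u -> in_l2 v ->
  flow alpha t (seq_plus u v) = seq_plus (flow alpha t u) (flow alpha t v).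
Proof.
  intros Ht Hu Hv. apply functional_extensionality. intros n. unfold flow, seq_plus at 3.
  rewrite !ip_plus_l by auto using in_l2_hrow. reflexivity.
Qed.

Lemma flow_scal t c u : 0 <= t -> in_l2 u ->
  flow alpha t (seq_scal c u) = seq_scal c (flow alpha t u).
Proof.
  intros Ht Hu. apply functional_extensionality. intros n. apply dot_inj. intros d.
  rewrite dot_flow by auto with l2. unfold seq_scal at 2. rewrite dot_mult_l, dot_flow, ip_mult_l by assumption.
  f_equal. unfold hrow. seq_eq.
Qed.

Lemma flow_opp t u : 0 <= t -> in_l2 u -> flow alpha t (seq_opp u) = seq_opp (flow alpha t u).
Proof.
  intros. replace (seq_opp u) with (seq_scal (RtoC (-1)) u) by seq_eq.
  rewrite flow_scal by assumption. seq_eq.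
Qed.

Lemma flow_minus t u v : 0 <= t -> in_l2 u -> in_l2 v ->
  flow alpha t (seq_minus u v) = seq_minus (flow alpha t u) (flow alpha t v).
Proof. intros. unfold seq_minus. now rewrite flow_plus, flow_opp by auto with l2. Qed.

Lemma flow_symmetric t u v : 0 <= t -> in_l2 u -> in_l2 v ->
  ip (flow alpha t u) v = ip u (flow alpha t v).
Proof.
  intros Ht Hu Hv.
  assert (Hf : forall N w, ip (flow alpha t u) (trunc N w) = ip u (flow alpha t (trunc N w))).
  { intros N w. apply (trunc_induct
      (fun w => in_l2 w /\ ip (flow alpha t u) w = ip u (flow alpha t w))).
    - intros c n. split; [auto with l2|].
      now rewrite flow_delta, ip_sym, ip_delta, dot_sym, dot_flow.
    - intros a b [Ia Ea] [Ib Eb]. split; [auto with l2|].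
      rewrite flow_plus, !ip_plus_r, Ea, Eb by auto with l2. reflexivity. }
  apply Rminus_diag_uniq. apply NNPP. intros Hne.
  assert (Hp := Rabs_pos_lt _ Hne). set (d := Rabs _) in Hp.
  assert (HU := l2_norm_pos u).
  destruct (trunc_dense v (d / (2 * (2 * l2_norm u + 1))) Hv) as [N HN].
  { apply Rdiv_lt_0_compat; lra. }
  set (w := trunc N v) in *. set (z := seq_minus v w) in *.
  assert (Iw : in_l2 w) by (unfold w; auto with l2).
  assert (Iz : in_l2 z) by (unfold z; auto with l2).
  assert (B : d <= 2 * l2_norm u * l2_norm z).
  { assert (E : ip (flow alpha t u) v - ip u (flow alpha t v)
              = ip (flow alpha t u) z - ip u (flow alpha t z)).
    { unfold z. rewrite flow_minus, !ip_minus_r by auto with l2.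
      unfold w. rewrite Hf. ring. }
    unfold d. rewrite E. unfold Rminus. eapply Rle_trans; [apply Rabs_triang|].
    rewrite Rabs_Ropp.
    assert (C1 := cauchy_schwarz (flow alpha t u) z ltac:(auto with l2) Iz).
    assert (C2 := cauchy_schwarz u (flow alpha t z) Hu ltac:(auto with l2)).
    assert (C3 := proj2 (flow_contraction t u Ht Hu)).
    assert (C4 := proj2 (flow_contraction t z Ht Iz)).
    assert (P1 := l2_norm_pos z). nra. }
  apply (Rmult_le_compat_l (2 * l2_norm u)) in HN; [|lra].
  assert (E : 2 * l2_norm u * (d / (2 * (2 * l2_norm u + 1))) < d).
  { apply (Rmult_lt_reg_r (2 * (2 * l2_norm u + 1))); [lra|].
    replace (2 * l2_norm u * (d / (2 * (2 * l2_norm u + 1))) * (2 * (2 * l2_norm u + 1)))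
      with (2 * l2_norm u * d) by (field; lra). nra. }
  lra.
Qed.

(** Up to sign, both sides are the time derivative of the kernel, computed with
    [tau] acting on one or on the other of its arguments. *)
Lemma tau_flow_delta t c n : 0 <= t ->
  tau alpha (flow alpha t (delta c n)) = flow alpha t (tau alpha (delta c n)).
Proof.
  intros Ht. apply functional_extensionality. intros m. apply dot_inj. intros d.
  rewrite dot_flow, flow_delta, ip_tau_delta, !tau_hrow by (assumption || apply in_l2_tau_delta).
  rewrite (heat_dt_sym alpha t m n) by lra. unfold dot. simpl. unfold Re, Im. ring.
Qed.

(** * Differentiability on finitely supported sequences *)

Lemma mean_value_two_sided f df r s :
  (forall q, Rmin r s <= q <= Rmax r s -> is_derive f q (df q)) ->
  exists c, Rmin r s <= c <= Rmax r s /\ f r - f s = df c * (r - s).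
Proof.
  intros H. destruct (Rle_dec s r) as [Hrs|Hrs].
  - rewrite Rmin_right, Rmax_left in * by lra.
    destruct (mean_value s r f df Hrs) as [c [Hc E]]; [|now exists c].
    intros q Hq. now apply is_derive_within, H.
  - rewrite Rmin_left, Rmax_right in * by lra.
    destruct (mean_value r s f df ltac:(lra)) as [c [Hc E]].
    + intros q Hq. now apply is_derive_within, H.
    + exists c. split; [assumption|]. lra.
Qed.

Lemma between_nonneg r s q : 0 <= r -> 0 <= s -> Rmin r s <= q <= Rmax r s ->
  0 <= q /\ Rabs (q - s) <= Rabs (r - s).
Proof.
  unfold Rmin, Rmax, Rabs. repeat (destruct (Rle_dec _ _) || destruct (Rcase_abs _)); lra.
Qed.

Lemma is_derive_test N f c n r : 0 <= r ->
  is_derive (fun r => ip (trunc N f) (flow alpha r (delta c n))) r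
    (- ip (trunc N f) (flow alpha r (tau alpha (delta c n)))).
Proof.
  intros Hr. rewrite <- tau_flow_delta, flow_delta, ip_trunc by assumption.
  apply (is_derive_ext (fun r => sum_n (fun m => dot (f m) c * heat alpha r n m) N)).
  { intros s. rewrite flow_delta, ip_trunc. apply sum_ext_le. intros m _.
    unfold hrow, dot. simpl. unfold Re, Im. ring. }
  rewrite (sum_ext_le _ (fun m => -1 * (dot (f m) c * heat_dt alpha r n m))).
  2: { intros m _. rewrite tau_hrow by assumption. unfold dot. simpl. unfold Re, Im. ring. }
  rewrite sum_scal.
  assert (E : forall x : R, - (-1 * x) = x) by (intros; ring). rewrite E.
  apply (is_derive_sum_n (V := R_NormedModule) (fun m r => dot (f m) c * heat alpha r n m)).
  intros m _. apply is_derive_scal. apply is_derive_heat; lra.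
Qed.

Lemma flow_lipschitz_delta c n r s : 0 <= r -> 0 <= s ->
  l2_norm (seq_minus (flow alpha r (delta c n)) (flow alpha s (delta c n)))
  <= l2_norm (tau alpha (delta c n)) * Rabs (r - s).
Proof.
  intros Hr Hs. assert (It := in_l2_tau_delta alpha c n).
  apply norm_le_test.
  { apply Rmult_le_pos; [apply l2_norm_pos|apply Rabs_pos]. }
  intros N f. rewrite ip_minus_r by auto with l2.
  destruct (mean_value_two_sided (fun r => ip (trunc N f) (flow alpha r (delta c n)))
    (fun r => - ip (trunc N f) (flow alpha r (tau alpha (delta c n)))) r s) as [q [Hq E]].
  { intros q Hq. apply is_derive_test. now apply (between_nonneg r s q). }
  destruct (between_nonneg r s q Hr Hs Hq) as [Hq0 _].
  rewrite E, Rabs_mult, Rabs_Ropp.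
  assert (C1 := cauchy_schwarz (trunc N f) (flow alpha q (tau alpha (delta c n)))
    ltac:(auto with l2) ltac:(auto with l2)).
  assert (C2 := proj2 (flow_contraction q _ Hq0 It)).
  assert (P1 := l2_norm_pos (trunc N f)). assert (P2 := Rabs_pos (r - s)).
  rewrite (Rmult_comm (l2_norm (tau _ _))), Rmult_assoc, Rmult_comm.
  apply Rmult_le_compat_l; [assumption|]. nra.
Qed.

Lemma flow_lipschitz N e : exists K, 0 <= K /\ forall r s, 0 <= r -> 0 <= s ->
  l2_norm (seq_minus (flow alpha r (trunc N e)) (flow alpha s (trunc N e))) <= K * Rabs (r - s).
Proof.
  apply (trunc_induct (fun e => in_l2 e /\ exists K, 0 <= K /\ forall r s, 0 <= r -> 0 <= s ->
    l2_norm (seq_minus (flow alpha r e) (flow alpha s e)) <= K * Rabs (r - s))).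
  - intros c n. split; [auto with l2|]. exists (l2_norm (tau alpha (delta c n))).
    split; [apply l2_norm_pos|]. intros. now apply flow_lipschitz_delta.
  - intros u v [Iu [K1 [HK1 H1]]] [Iv [K2 [HK2 H2]]]. split; [auto with l2|].
    exists (K1 + K2). split; [lra|]. intros r s Hr Hs.
    rewrite !flow_plus by assumption.
    replace (seq_minus _ _) with (seq_plus (seq_minus (flow alpha r u) (flow alpha s u))
      (seq_minus (flow alpha r v) (flow alpha s v))) by seq_eq.
    eapply Rle_trans; [apply l2_norm_plus; auto 6 with l2|].
    specialize (H1 r s Hr Hs). specialize (H2 r s Hr Hs). lra.
Qed.

Definition taylor_rest (e : cseq) (r s : R) : cseq :=
  seq_plus (seq_minus (flow alpha r e) (flow alpha s e))
           (seq_scal (RtoC (r - s)) (flow alpha s (tau alpha e))).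

(** First-order expansion, with a quadratic remainder because the generator
    maps finitely supported sequences to such sequences. *)
Lemma flow_taylor_delta c n : exists K, 0 <= K /\ forall r s, 0 <= r -> 0 <= s ->
  l2_norm (taylor_rest (delta c n) r s) <= K * Rabs (r - s) * Rabs (r - s).
Proof.
  assert (It := in_l2_tau_delta alpha c n).
  assert (Et : trunc (S n) (tau alpha (delta c n)) = tau alpha (delta c n)).
  { apply functional_extensionality. intros m. destruct (Nat.le_gt_cases m (S n)).
    - now apply trunc_le.
    - rewrite trunc_gt, tau_delta_support by assumption. reflexivity. }
  destruct (flow_lipschitz (S n) (tau alpha (delta c n))) as [K [HK HL]]. rewrite Et in HL.
  exists K. split; [assumption|]. intros r s Hr Hs.
  apply norm_le_test.
  { assert (H := Rabs_pos (r - s)). repeat apply Rmult_le_pos; assumption. }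
  intros N f. set (g := trunc N f). assert (Ig : in_l2 g) by (unfold g; auto with l2).
  set (td := tau alpha (delta c n)) in *.
  destruct (mean_value_two_sided
    (fun q => ip g (flow alpha q (delta c n)) + q * ip g (flow alpha s td))
    (fun q => - ip g (flow alpha q td) + ip g (flow alpha s td)) r s) as [q [Hq E]].
  { intros q Hq. destruct (between_nonneg r s q Hr Hs Hq) as [Hq0 _].
    assert (D1 := is_derive_test N f c n q Hq0).
    assert (D2 : is_derive (fun q => q * ip g (flow alpha s td)) q (ip g (flow alpha s td))).
    { auto_derive; [exact I|ring]. }
    exact (is_derive_plus (V := R_NormedModule) _ _ _ _ _ D1 D2). }
  destruct (between_nonneg r s q Hr Hs Hq) as [Hq0 Hqs].
  unfold taylor_rest. fold td.
  rewrite ip_plus_r, ip_minus_r, ip_scal_r by auto with l2.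
  replace (ip g (flow alpha r (delta c n)) - ip g (flow alpha s (delta c n))
    + (r - s) * ip g (flow alpha s td))
    with ((- ip g (flow alpha q td) + ip g (flow alpha s td)) * (r - s)) by (rewrite <- E; ring).
  replace (- ip g (flow alpha q td) + ip g (flow alpha s td))
    with (- (ip g (flow alpha q td) - ip g (flow alpha s td))) by ring.
  rewrite Rabs_mult, Rabs_Ropp, <- ip_minus_r by auto with l2.
  assert (C1 := cauchy_schwarz g (seq_minus (flow alpha q td) (flow alpha s td)) Ig ltac:(auto with l2)).
  specialize (HL q s Hq0 Hs).
  assert (P1 := l2_norm_pos g). assert (P2 := Rabs_pos (r - s)).
  assert (B : Rabs (ip g (seq_minus (flow alpha q td) (flow alpha s td)))
            <= l2_norm g * (K * Rabs (r - s))).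
  { eapply Rle_trans; [exact C1|]. apply Rmult_le_compat_l; [assumption|].
    eapply Rle_trans; [exact HL|]. now apply Rmult_le_compat_l. }
  replace (K * Rabs (r - s) * Rabs (r - s) * l2_norm g)
    with (l2_norm g * (K * Rabs (r - s)) * Rabs (r - s)) by ring.
  now apply Rmult_le_compat_r.
Qed.

(** The properties of unit vectors that pass to their combinations and are all
    that the duality arguments need of a test sequence. *)
Record regular (e : cseq) : Prop := {
  reg_l2 : in_l2 e;
  reg_tau : in_l2 (tau alpha e);
  reg_comm : forall t, 0 <= t -> tau alpha (flow alpha t e) = flow alpha t (tau alpha e);
  reg_taylor : exists K, 0 <= K /\ forall r s, 0 <= r -> 0 <= s ->
    l2_norm (taylor_rest e r s) <= K * Rabs (r - s) * Rabs (r - s)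
}.

Lemma regular_delta c n : regular (delta c n).
Proof.
  split.
  - auto with l2.
  - apply in_l2_tau_delta.
  - intros. now apply tau_flow_delta.
  - apply flow_taylor_delta.
Qed.

Lemma regular_trunc N e : regular (trunc N e).
Proof.
  apply trunc_induct; [apply regular_delta|].
  intros u v [Iu Tu Cu [K1 [HK1 H1]]] [Iv Tv Cv [K2 [HK2 H2]]]. split.
  - auto with l2.
  - rewrite tau_plus. auto with l2.
  - intros t Ht. rewrite flow_plus, !tau_plus, flow_plus, Cu, Cv by assumption. reflexivity.
  - exists (K1 + K2). split; [lra|]. intros r s Hr Hs.
    replace (taylor_rest (seq_plus u v) r s) with
      (seq_plus (taylor_rest u r s) (taylor_rest v r s)).
    + eapply Rle_trans; [apply l2_norm_plus; unfold taylor_rest; auto 6 with l2|].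
      specialize (H1 r s Hr Hs). specialize (H2 r s Hr Hs). lra.
    + unfold taylor_rest. rewrite tau_plus, !flow_plus by assumption. seq_eq.
Qed.

Lemma flow_der_within a b e s : regular e -> 0 <= a -> 0 <= s ->
  seq_der_within a b (fun r => flow alpha r e) s (seq_opp (flow alpha s (tau alpha e))).
Proof.
  intros [_ _ _ [K [HK H]]] Ha0 Hs eps He.
  exists (eps / (K + 1)). split; [apply Rdiv_lt_0_compat; lra|].
  intros r Hr Hrs. specialize (H r s ltac:(lra) Hs).
  replace (seq_minus _ _) with (taylor_rest e r s) by (unfold taylor_rest; seq_eq).
  eapply Rle_trans; [exact H|]. apply Rmult_le_compat_r; [apply Rabs_pos|].
  apply (Rmult_lt_compat_l (K + 1)) in Hrs; [|lra].
  replace ((K + 1) * (eps / (K + 1))) with eps in Hrs by (field; lra).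
  assert (H0 := Rabs_pos (r - s)). lra.
Qed.
End Flow.


Lemma vanishing_at_right (w : R -> cseq) :
  filterlim (fun t => l2_norm (w t)) (at_right 0) (locally 0) <->
  (forall eps, 0 < eps -> exists d, 0 < d /\ forall t, 0 < t < d -> l2_norm (w t) < eps).
Proof.
  rewrite (filterlim_locally (F := at_right 0) (fun t => l2_norm (w t)) 0). split.
  - intros H eps He. destruct (H (mkposreal _ He)) as [d Hd]. exists d. split; [apply cond_pos|].
    intros t Ht.
    assert (B := Hd t). unfold ball in B; simpl in B; unfold AbsRing_ball, abs, minus, plus, opp in B; simpl in B.
    rewrite Ropp_0, !Rplus_0_r in B.
    rewrite (Rabs_pos_eq t), Rabs_pos_eq in B by (apply l2_norm_pos || lra).
    apply B; lra.
  - intros H eps. destruct (H eps (cond_pos eps)) as [d [Hd Hw]]. exists (mkposreal _ Hd).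
    intros t B Ht.
    unfold ball in *; simpl in *; unfold AbsRing_ball, abs, minus, plus, opp in *; simpl in *.
    rewrite Ropp_0, !Rplus_0_r in *. rewrite Rabs_pos_eq in B by lra.
    rewrite Rabs_pos_eq by apply l2_norm_pos. apply Hw. lra.
Qed.

(** * The generator of the flow *)

Section Generator.
Variable alpha : R.
Hypothesis Ha : -1 < alpha.
Hint Resolve in_l2_flow : l2.

(** Uniqueness for the heat equation. Pairing a solution with the flow of a
    unit vector run backwards gives a function whose derivative vanishes,
    because [tau] is symmetric on the maximal domain. *)
Lemma heat_equation_unique a b (F : R -> cseq) : 0 <= a -> a <= b ->
  (forall r, a <= r <= b -> in_l2 (F r) /\ in_l2 (tau alpha (F r)) /\
     seq_der_within a b F r (seq_opp (tau alpha (F r)))) ->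
  F b = flow alpha (b - a) (F a).
Proof.
  intros Ha0 Hab HF. apply functional_extensionality. intros n. apply dot_inj. intros c.
  destruct (HF a ltac:(lra)) as [Ia _]. destruct (HF b ltac:(lra)) as [Ib _].
  rewrite dot_flow, <- flow_delta by (assumption || lra).
  destruct (regular_delta alpha Ha c n) as [Ie Ite Comm [K [HK Tay]]].
  set (e := delta c n) in *. set (G := fun r => flow alpha (b - r) e).
  assert (IG : forall r, a <= r <= b -> in_l2 (G r)) by (intros; unfold G; apply in_l2_flow; auto; lra).
  assert (ItG : forall r, a <= r <= b -> in_l2 (tau alpha (G r))).
  { intros. unfold G. rewrite Comm by lra. apply in_l2_flow; auto; lra. }
  assert (DG : forall s, a <= s <= b -> seq_der_within a b G s (tau alpha (G s))).
  { intros s Hs eps He. exists (eps / (K + 1)). split; [apply Rdiv_lt_0_compat; lra|].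
    intros r Hr Hrs. specialize (Tay (b - r) (b - s) ltac:(lra) ltac:(lra)).
    replace (seq_minus _ _) with (taylor_rest alpha e (b - r) (b - s)).
    - replace (b - r - (b - s)) with (- (r - s)) in Tay by ring. rewrite Rabs_Ropp in Tay.
      eapply Rle_trans; [exact Tay|]. apply Rmult_le_compat_r; [apply Rabs_pos|].
      apply (Rmult_lt_compat_l (K + 1)) in Hrs; [|lra].
      replace ((K + 1) * (eps / (K + 1))) with eps in Hrs by (field; lra).
      assert (H0 := Rabs_pos (r - s)). lra.
    - unfold taylor_rest, G. rewrite Comm by lra. seq_eq. }
  destruct (mean_value a b (fun r => ip (F r) (G r))
    (fun s => ip (seq_opp (tau alpha (F s))) (G s) + ip (F s) (tau alpha (G s))) Hab) as [q [Hq E]].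
  { intros s Hs. destruct (HF s Hs) as [I1 [I2 D]].
    apply ip_der_within; auto with l2. intros r Hr. now apply HF. }
  destruct (HF q Hq) as [I1 [I2 _]].
  rewrite ip_opp_l, tau_symmetric in E by auto.
  assert (E' : ip (F b) (G b) = ip (F a) (G a)) by lra.
  unfold G in E'. replace (b - b) with 0 in E' by ring.
  rewrite flow_0, ip_sym in E' by auto. unfold e in E' at 1. rewrite ip_delta, dot_sym in E'. exact E'.
Qed.

Lemma flow_add s t u : 0 <= s -> 0 <= t -> in_l2 u ->
  flow alpha (s + t) u = flow alpha s (flow alpha t u).
Proof.
  intros Hs Ht Hu. apply functional_extensionality. intros n. apply dot_inj. intros c.
  assert (Hst : 0 <= s + t) by lra.
  rewrite !dot_flow by (assumption || now apply in_l2_flow). rewrite <- !flow_delta.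
  rewrite (flow_symmetric alpha Ha t u) by auto with l2. f_equal.
  destruct (regular_delta alpha Ha c n) as [Ie Ite Comm _].
  rewrite (heat_equation_unique s (s + t) (fun r => flow alpha r (delta c n))); [|lra..|].
  2: { intros r Hr. rewrite Comm by lra. split; [|split].
       - apply in_l2_flow; auto; lra.
       - apply in_l2_flow; auto; lra.
       - apply flow_der_within; auto using regular_delta; lra. }
  f_equal. ring.
Qed.

Lemma flow_continuous u eps : in_l2 u -> 0 < eps -> exists d, 0 < d /\
  forall t, 0 <= t < d -> l2_norm (seq_minus (flow alpha t u) u) < eps.
Proof.
  intros Hu He. destruct (trunc_dense u (eps / 3) Hu ltac:(lra)) as [N HN].
  destruct (flow_lipschitz alpha Ha N u) as [K [HK HL]].
  set (v := trunc N u) in *. assert (Iv : in_l2 v) by (unfold v; auto with l2).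
  exists (eps / 3 / (K + 1)). split; [repeat apply Rdiv_lt_0_compat; lra|].
  intros t Ht. specialize (HL t 0 ltac:(lra) ltac:(lra)).
  rewrite (flow_0 alpha Ha v Iv), Rminus_0_r, Rabs_pos_eq in HL by lra.
  replace (seq_minus (flow alpha t u) u) with
    (seq_plus (flow alpha t (seq_minus u v)) (seq_plus (seq_minus (flow alpha t v) v)
       (seq_opp (seq_minus u v)))).
  2: { rewrite flow_minus by (auto; lra). seq_eq. }
  assert (I1 : in_l2 (seq_minus u v)) by auto with l2.
  assert (I2 : in_l2 (flow alpha t v)) by (apply in_l2_flow; auto; lra).
  eapply Rle_lt_trans; [apply l2_norm_plus; auto with l2; apply in_l2_flow; auto; lra|].
  assert (P1 := proj2 (flow_contraction alpha Ha t _ (proj1 Ht) I1)).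
  assert (P2 := l2_norm_plus (seq_minus (flow alpha t v) v) (seq_opp (seq_minus u v))
    ltac:(auto with l2) ltac:(auto with l2)).
  rewrite l2_norm_opp in P2 by assumption.
  assert (P3 : K * t < eps / 3).
  { destruct Ht as [Ht0 Ht]. apply (Rmult_lt_compat_l (K + 1)) in Ht; [|lra].
    replace ((K + 1) * (eps / 3 / (K + 1))) with (eps / 3) in Ht by (field; lra). lra. }
  lra.
Qed.

(** The increment of the flow on the maximal domain, tested against finitely
    supported sequences: there [tau] may be moved onto the test sequence and
    back, so that the mean value theorem bounds the remainder by the modulus of
    continuity of the flow at [tau alpha u]. *)
Lemma flow_increment u t eps : 0 <= t -> 0 <= eps -> in_l2 u -> in_l2 (tau alpha u) ->
  (forall s, 0 <= s <= t -> l2_norm (seq_minus (flow alpha s (tau alpha u)) (tau alpha u)) <= eps) ->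
  l2_norm (seq_plus (seq_minus (flow alpha t u) u) (seq_scal (RtoC t) (tau alpha u))) <= t * eps.
Proof.
  intros Ht He Hu Htu Hs. apply norm_le_test; [nra|]. intros N f.
  destruct (regular_trunc alpha Ha N f) as [Ie Ite Comm _].
  set (g := trunc N f) in *. set (v := tau alpha u) in *.
  assert (Hc : forall q, seq_der_within 0 t (fun _ => u) q zeroseq).
  { intros q e He'. exists 1. split; [lra|]. intros r _ _.
    replace (seq_minus _ _) with zeroseq by seq_eq. rewrite l2_norm_zero.
    apply Rmult_le_pos; [lra|apply Rabs_pos]. }
  destruct (mean_value 0 t (fun r => ip u (flow alpha r g) + r * ip v g)
    (fun q => ip zeroseq (flow alpha q g) + ip u (seq_opp (flow alpha q (tau alpha g))) + ip v g) Ht)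
    as [q [Hq E]].
  { intros q Hq e He'.
    assert (D : der_within 0 t (fun r => ip u (flow alpha r g)) q
      (ip zeroseq (flow alpha q g) + ip u (seq_opp (flow alpha q (tau alpha g))))).
    { apply (ip_der_within 0 t (fun _ => u) (fun r => flow alpha r g)); auto with l2.
      - intros r Hr. apply in_l2_flow; auto; lra.
      - apply in_l2_opp, in_l2_flow; auto; lra.
      - apply flow_der_within; try lra. now apply regular_trunc. }
    destruct (D e He') as [eta [Heta D']]. exists eta. split; [assumption|].
    intros r Hr Hrq. specialize (D' r Hr Hrq).
    match goal with |- Rabs ?x <= _ => match type of D' with Rabs ?y <= _ =>
      replace x with y by ring end end. exact D'. }
  assert (I1 : in_l2 (flow alpha q v)) by (apply in_l2_flow; auto; lra).
  assert (I2 : in_l2 (flow alpha t u)) by (apply in_l2_flow; auto).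
  assert (I3 : in_l2 (flow alpha q g)) by (apply in_l2_flow; auto; lra).
  assert (E1 : ip u (flow alpha q (tau alpha g)) = ip (flow alpha q v) g).
  { rewrite flow_symmetric by (auto; lra). rewrite <- Comm by lra.
    symmetry. apply tau_symmetric; auto. rewrite Comm by lra. apply in_l2_flow; auto; lra. }
  rewrite flow_0, <- (flow_symmetric alpha Ha t u g) in E by auto.
  rewrite ip_plus_r, ip_minus_r, ip_scal_r by auto with l2.
  assert (Ez : ip zeroseq (flow alpha q g) = 0).
  { replace zeroseq with (seq_scal (RtoC 0) zeroseq) by seq_eq. rewrite ip_scal_l. ring. }
  rewrite Ez, (ip_sym u (seq_opp _)), ip_opp_l, (ip_sym _ u), E1 in E.
  rewrite (ip_sym g (flow alpha t u)), (ip_sym g u), (ip_sym g v).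
  replace (ip (flow alpha t u) g - ip u g + t * ip v g)
    with (- (ip (flow alpha q v) g - ip v g) * t) by lra.
  rewrite <- ip_minus_l, Rabs_mult, Rabs_Ropp, (Rabs_pos_eq t) by auto with l2.
  assert (C1 := cauchy_schwarz (seq_minus (flow alpha q v) v) g ltac:(auto with l2) Ie).
  specialize (Hs q Hq). assert (P := l2_norm_pos g).
  assert (B : Rabs (ip (seq_minus (flow alpha q v) v) g) <= eps * l2_norm g).
  { eapply Rle_trans; [exact C1|]. now apply Rmult_le_compat_r. }
  apply (Rmult_le_compat_r t) in B; [|assumption]. lra.
Qed.

Definition difference_error (T : R -> cseq -> cseq) (u v : cseq) (t : R) : cseq :=
  seq_minus (seq_scal (RtoC (/ t)) (seq_minus (T t u) u)) v.

Lemma flow_generator_dom u : in_l2 u -> in_l2 (tau alpha u) ->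
  generator_graph (flow alpha) u (seq_opp (tau alpha u)).
Proof.
  intros Hu Htu. split; [assumption|]. split; [auto with l2|].
  apply (vanishing_at_right (difference_error (flow alpha) u (seq_opp (tau alpha u)))).
  intros eps He. destruct (flow_continuous (tau alpha u) (eps / 2) Htu ltac:(lra)) as [d [Hd H]].
  exists d. split; [assumption|]. intros t Ht.
  assert (B := flow_increment u t (eps / 2) ltac:(lra) ltac:(lra) Hu Htu).
  replace (difference_error _ _ _ t) with (seq_scal (RtoC (/ t))
    (seq_plus (seq_minus (flow alpha t u) u) (seq_scal (RtoC t) (tau alpha u)))).
  - rewrite l2_norm_scal by (apply in_l2_plus; [apply in_l2_minus; [apply in_l2_flow|]|]; auto with l2; lra).
    assert (Hi : 0 < / t) by (apply Rinv_0_lt_compat; lra).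
    rewrite Rabs_pos_eq by lra.
    apply Rle_lt_trans with (eps / 2); [|lra].
    replace (eps / 2) with (/ t * (t * (eps / 2))) by (field; lra).
    apply Rmult_le_compat_l; [lra|]. apply B. intros s Hs. left. apply H. lra.
  - unfold difference_error. apply functional_extensionality; intro.
    unfold seq_minus, seq_plus, seq_opp, seq_scal. apply injective_projections; simpl; field; lra.
Qed.

(** Testing the limit against unit vectors, on which the flow is
    differentiable, identifies the generator entrywise. *)
Lemma flow_generator_graph u v : generator_graph (flow alpha) u v ->
  v = seq_opp (tau alpha u).
Proof.
  intros [Hu [Hv Hlim]].
  assert (Hlim' := proj1 (vanishing_at_right (difference_error (flow alpha) u v)) Hlim).
  clear Hlim. rename Hlim' into Hlim.
  apply functional_extensionality. intros n. apply dot_inj. intros c.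
  set (e := delta c n).
  destruct (regular_delta alpha Ha c n) as [Ie Ite _ [K [HK Tay]]]. fold e in Ie, Ite, Tay.
  assert (E : ip v e = - ip u (tau alpha e)).
  { apply Rminus_diag_uniq. apply NNPP. intros Hne. assert (Hp := Rabs_pos_lt _ Hne).
    set (x := Rabs _) in Hp. assert (P1 := l2_norm_pos e). assert (P2 := l2_norm_pos u).
    set (M := l2_norm e + l2_norm u * K + 1).
    assert (HM : 1 <= M) by (unfold M; nra).
    destruct (Hlim (x / (2 * M))) as [d [Hd H]]; [apply Rdiv_lt_0_compat; lra|].
    set (t := Rmin (d / 2) (x / (2 * M))).
    assert (Ht0 : 0 < t) by (apply Rmin_glb_lt; [lra|apply Rdiv_lt_0_compat; lra]).
    assert (Ht1 : t <= d / 2) by apply Rmin_l.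
    assert (Ht2 : t <= x / (2 * M)) by apply Rmin_r.
    specialize (H t ltac:(lra)). specialize (Tay t 0 ltac:(lra) ltac:(lra)).
    unfold taylor_rest in Tay.
    rewrite !(flow_0 alpha Ha), Rminus_0_r, (Rabs_pos_eq t) in Tay by (assumption || lra).
    set (Z := difference_error (flow alpha) u v t) in *.
    assert (If : in_l2 (flow alpha t u)) by (apply in_l2_flow; auto; lra).
    assert (Ig : in_l2 (flow alpha t e)) by (apply in_l2_flow; auto; lra).
    assert (IZ : in_l2 Z) by (unfold Z, difference_error; auto with l2).
    set (Y := seq_plus (seq_minus (flow alpha t e) e) (seq_scal (RtoC t) (tau alpha e))) in *.
    assert (IY : in_l2 Y) by (unfold Y; auto with l2).
    assert (EE : ip v e - - ip u (tau alpha e) = - ip Z e + / t * ip u Y).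
    { unfold Z, Y, difference_error.
      rewrite !ip_minus_l, ip_scal_l, ip_minus_l, ip_plus_r, ip_minus_r, ip_scal_r by auto with l2.
      rewrite flow_symmetric by (auto; lra). field. lra. }
    assert (Hi : 0 < / t) by now apply Rinv_0_lt_compat.
    assert (B : x <= l2_norm Z * l2_norm e + / t * (l2_norm u * l2_norm Y)).
    { unfold x. rewrite EE. eapply Rle_trans; [apply Rabs_triang|].
      rewrite Rabs_Ropp, Rabs_mult, (Rabs_pos_eq (/ t)) by lra.
      apply Rplus_le_compat; [now apply cauchy_schwarz|].
      apply Rmult_le_compat_l; [lra|now apply cauchy_schwarz]. }
    assert (B2 : / t * (l2_norm u * l2_norm Y) <= l2_norm u * K * t).
    { replace (l2_norm u * K * t) with (/ t * (l2_norm u * (K * t * t))) by (field; lra).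
      apply Rmult_le_compat_l; [lra|]. now apply Rmult_le_compat_l. }
    assert (Q := l2_norm_pos Z).
    assert (B3 : x <= x / (2 * M) * (l2_norm e + l2_norm u * K)).
    { assert (0 <= l2_norm u * K) by nra. nra. }
    assert (B4 : x / (2 * M) * (l2_norm e + l2_norm u * K) <= x / 2).
    { replace (x / 2) with (x / (2 * M) * M) by (field; lra).
      apply Rmult_le_compat_l; [left; apply Rdiv_lt_0_compat; lra|unfold M; lra]. }
    lra. }
  assert (E2 := E). rewrite (ip_sym v), (ip_sym u) in E2. unfold e in E2.
  rewrite ip_delta, ip_tau_delta in E2.
  rewrite dot_sym, E2. unfold seq_opp, dot. simpl. unfold Re, Im. ring.
Qed.

Lemma flow_generates : generates (laguerre alpha) (flow alpha).
Proof.
  split; [split|].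
  - intros t u Ht Hu. auto with l2.
  - intros. now apply flow_plus.
  - intros. now apply flow_scal.
  - intros t Ht. exists 1. intros u Hu. rewrite Rmult_1_l. now apply flow_contraction.
  - intros. now apply flow_0.
  - intros. now apply flow_add.
  - intros u Hu. apply (vanishing_at_right (fun t => seq_minus (flow alpha t u) u)).
    intros eps He. destruct (flow_continuous u eps Hu He) as [d [Hd H]].
    exists d. split; [assumption|]. intros t Ht. apply H. lra.
  - intros u v. simpl. split.
    + intros HG. assert (E := flow_generator_graph u v HG). destruct HG as [Hu [Hv _]].
      repeat split; try assumption.
      replace (tau alpha u) with (seq_opp v) by (rewrite E; seq_eq). auto with l2.
    + intros [[Hu Htu] ->]. now apply flow_generator_dom.
Qed.
End Generator.


(** * Uniqueness of the generated semigroup *)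

Section UniqueGeneration.
Variable T : R -> cseq -> cseq.
Hypothesis HT : C0_semigroup T.

Lemma semigroup_minus t u v : 0 <= t -> in_l2 u -> in_l2 v ->
  T t (seq_minus u v) = seq_minus (T t u) (T t v).
Proof.
  intros Ht Hu Hv. unfold seq_minus.
  replace (seq_opp v) with (seq_scal (RtoC (-1)) v) by seq_eq.
  rewrite (sg_plus T HT), (sg_scal T HT) by auto with l2. seq_eq.
Qed.

Lemma in_l2_semigroup t u : 0 <= t -> in_l2 u -> in_l2 (T t u).
Proof. apply (sg_l2 T HT). Qed.
Hint Resolve in_l2_semigroup : l2.

Lemma semigroup_tends eps u : in_l2 u -> 0 < eps -> exists d, 0 < d /\
  forall t, 0 <= t < d -> l2_norm (seq_minus (T t u) u) < eps.
Proof.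
  intros Hu He.
  destruct (proj1 (vanishing_at_right (fun t => seq_minus (T t u) u)) (sg_cont T HT u Hu) eps He)
    as [d [Hd H]].
  exists d. split; [assumption|]. intros t Ht. destruct (Req_dec t 0) as [->|Hne].
  - rewrite (sg_0 T HT) by assumption. replace (seq_minus u u) with zeroseq by seq_eq.
    now rewrite l2_norm_zero.
  - apply H. lra.
Qed.

(** An operator of large norm is large on a whole ball inside any given ball:
    move the centre by a vector of large image, with the better sign. *)
Lemma large_on_ball t K x r : 0 <= t -> in_l2 x -> 0 < r -> 0 <= K ->
  (exists v, in_l2 v /\ 2 * (K + 1) / r * l2_norm v < l2_norm (T t v)) ->
  exists x' r', in_l2 x' /\ 0 < r' /\ r' <= r / 2 /\ l2_norm (seq_minus x' x) <= r / 2 /\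
    forall y, in_l2 y -> l2_norm (seq_minus y x') <= r' -> K <= l2_norm (T t y).
Proof.
  intros Ht Hx Hr HK [v [Hv Hbig]].
  assert (Pv := l2_norm_pos v).
  assert (HKr : 0 < 2 * (K + 1) / r) by (apply Rdiv_lt_0_compat; lra).
  destruct (sg_bounded T HT t Ht) as [M HM].
  assert (Hv0 : 0 < l2_norm v).
  { destruct (Req_dec (l2_norm v) 0) as [E|E]; [|lra]. specialize (HM v Hv). nra. }
  set (c := r / (2 * l2_norm v)).
  assert (Hc : 0 < c) by (apply Rdiv_lt_0_compat; lra).
  set (w := seq_scal (RtoC c) v). assert (Iw : in_l2 w) by (unfold w; auto with l2).
  assert (Nw : l2_norm w = r / 2).
  { unfold w. rewrite l2_norm_scal, Rabs_pos_eq by (assumption || lra). unfold c. field. lra. }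
  assert (NTw : K + 1 < l2_norm (T t w)).
  { unfold w. rewrite (sg_scal T HT), l2_norm_scal, Rabs_pos_eq by (auto with l2; lra).
    apply (Rmult_lt_compat_l c) in Hbig; [|assumption].
    replace (c * (2 * (K + 1) / r * l2_norm v)) with (K + 1) in Hbig; [assumption|].
    unfold c. field. lra. }
  assert (Hx' : exists x', in_l2 x' /\ l2_norm (seq_minus x' x) <= r / 2 /\ K + 1 <= l2_norm (T t x')).
  { assert (ITx : in_l2 (T t x)) by auto with l2. assert (ITw : in_l2 (T t w)) by auto with l2.
    assert (D : 2 * l2_norm (T t w) <= l2_norm (T t (seq_plus x w)) + l2_norm (T t (seq_minus x w))).
    { rewrite semigroup_minus, (sg_plus T HT) by assumption.
      replace (2 * l2_norm (T t w)) with (l2_norm (seq_scal (RtoC 2) (T t w)))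
        by (rewrite l2_norm_scal, Rabs_pos_eq by (assumption || lra); ring).
      replace (seq_scal (RtoC 2) (T t w)) with
        (seq_minus (seq_plus (T t x) (T t w)) (seq_minus (T t x) (T t w))) by seq_eq.
      apply l2_norm_minus; auto with l2. }
    destruct (Rle_dec (K + 1) (l2_norm (T t (seq_plus x w)))) as [H|H].
    - exists (seq_plus x w). repeat split; [auto with l2| |assumption].
      replace (seq_minus (seq_plus x w) x) with w by seq_eq. lra.
    - exists (seq_minus x w). repeat split; [auto with l2| |lra].
      replace (seq_minus (seq_minus x w) x) with (seq_opp w) by seq_eq.
      rewrite l2_norm_opp by assumption. lra. }
  destruct Hx' as [x' [Ix' [Nx' NTx']]].
  assert (HM0 : 0 <= Rabs M) by apply Rabs_pos.
  exists x', (Rmin (r / 2) (/ (Rabs M + 1))).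
  split; [assumption|]. split.
  { apply Rmin_glb_lt; [lra|]. apply Rinv_0_lt_compat. lra. }
  split; [apply Rmin_l|]. split; [assumption|].
  intros y Iy Hy.
  assert (Hy' := Rle_trans _ _ _ Hy (Rmin_r _ _)).
  assert (B : l2_norm (T t (seq_minus y x')) <= 1).
  { eapply Rle_trans; [apply HM; auto with l2|].
    apply Rle_trans with ((Rabs M + 1) * l2_norm (seq_minus y x')).
    - apply Rmult_le_compat_r; [apply l2_norm_pos|]. assert (H := Rle_abs M). lra.
    - apply (Rmult_le_compat_l (Rabs M + 1)) in Hy'; [|lra].
      rewrite Rinv_r in Hy' by lra. assumption. }
  rewrite semigroup_minus in B by assumption.
  assert (D : l2_norm (T t x') <= l2_norm (T t y) + l2_norm (seq_minus (T t y) (T t x'))).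
  { replace (T t x') with (seq_minus (T t y) (seq_minus (T t y) (T t x'))) at 1 by seq_eq.
    apply l2_norm_minus; auto with l2. }
  lra.
Qed.

(** Uniform boundedness near 0. Otherwise nested balls would give a vector
    whose orbit is unbounded along a sequence of times decreasing to 0. *)
Lemma semigroup_locally_bounded : exists d M, 0 < d /\ 0 <= M /\
  forall t u, 0 <= t <= d -> in_l2 u -> l2_norm (T t u) <= M * l2_norm u.
Proof.
  apply NNPP. intros Hno.
  assert (Hbad : forall d M, 0 < d -> 0 <= M -> exists t, 0 <= t <= d /\
    exists v, in_l2 v /\ M * l2_norm v < l2_norm (T t v)).
  { intros d M Hd HM. apply NNPP. intros Hn. apply Hno. exists d, M. repeat split; try assumption.
    intros t u Ht Hu. apply Rnot_lt_le. intros Hlt. apply Hn. exists t. split; [assumption|].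
    now exists u. }
  set (good := fun (q : nat * (cseq * R)) (p' : cseq * R) =>
    let '(n, (x, r)) := q in in_l2 x -> 0 < r ->
    in_l2 (fst p') /\ 0 < snd p' /\ snd p' <= r / 2 /\ l2_norm (seq_minus (fst p') x) <= r / 2 /\
    exists t, 0 <= t <= / (INR n + 1) /\
      forall y, in_l2 y -> l2_norm (seq_minus y (fst p')) <= snd p' -> INR n <= l2_norm (T t y)).
  destruct (choice good) as [step Hstep].
  { intros [n [x r]]. unfold good.
    destruct (classic (in_l2 x /\ 0 < r)) as [[Hx Hr]|Hn]; [|exists (x, r); tauto].
    assert (Hn0 := pos_INR n).
    destruct (Hbad (/ (INR n + 1)) (2 * (INR n + 1) / r)) as [t [Ht Hv]].
    - apply Rinv_0_lt_compat. lra.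
    - left. apply Rdiv_lt_0_compat; lra.
    - destruct (large_on_ball t (INR n) x r) as [x' [r' [I1 [I2 [I3 [I4 I5]]]]]];
        try assumption; [lra|].
      exists (x', r'). intros _ _. simpl. repeat split; try assumption.
      exists t. now split. }
  set (p := fix p n := match n with O => (zeroseq, 1) | S k => step (k, p k) end).
  assert (Hp : forall n, in_l2 (fst (p n)) /\ 0 < snd (p n)).
  { induction n as [|n [I1 I2]]; [split; [apply in_l2_zero|simpl; lra]|].
    assert (H := Hstep (n, p n)). unfold good in H.
    change (p (S n)) with (step (n, p n)). destruct (p n) as [x r]. simpl in I1, I2.
    destruct (H I1 I2) as [J1 [J2 _]]. now split. }
  assert (Hs : forall n, snd (p (S n)) <= snd (p n) / 2 /\
    l2_norm (seq_minus (fst (p (S n))) (fst (p n))) <= snd (p n) / 2 /\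
    exists t, 0 <= t <= / (INR n + 1) /\ forall y, in_l2 y ->
      l2_norm (seq_minus y (fst (p (S n)))) <= snd (p (S n)) -> INR n <= l2_norm (T t y)).
  { intros n. assert (H := Hstep (n, p n)). unfold good in H. destruct (Hp n) as [I1 I2].
    change (p (S n)) with (step (n, p n)). destruct (p n) as [x r]. simpl in *.
    destruct (H I1 I2) as [_ [_ J]]. exact J. }
  destruct (nested_balls (fun n => fst (p n)) (fun n => snd (p n))) as [y [Iy Hy]];
    try (intros n; apply Hp); try (intros n; apply Hs).
  destruct (semigroup_tends 1 y Iy ltac:(lra)) as [d [Hd Hlim]].
  destruct (INR_unbounded (/ d + l2_norm y + 1)) as [n Hn].
  assert (P := l2_norm_pos y). assert (Hdi : 0 < / d) by now apply Rinv_0_lt_compat.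
  destruct (Hs n) as [_ [_ [t [Ht Hbig]]]]. specialize (Hbig y Iy (Hy (S n))).
  assert (Htd : t < d).
  { apply Rle_lt_trans with (/ (INR n + 1)); [apply Ht|].
    rewrite <- (Rinv_inv d). apply Rinv_lt_contravar; [apply Rmult_lt_0_compat; lra|lra]. }
  specialize (Hlim t ltac:(lra)).
  assert (D : l2_norm (T t y) <= l2_norm (seq_minus (T t y) y) + l2_norm y).
  { replace (T t y) with (seq_plus (seq_minus (T t y) y) y) at 1 by seq_eq.
    assert (in_l2 (T t y)) by (apply in_l2_semigroup; [lra|assumption]).
    apply l2_norm_plus; auto with l2. }
  lra.
Qed.

Variable alpha : R.
Hypothesis Ha : -1 < alpha.
Hypothesis HG : forall u v, generator_graph T u v <->
  op_dom (laguerre alpha) u /\ v = seq_opp (op_fun (laguerre alpha) u).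

Lemma semigroup_increment u eps : in_l2 u -> in_l2 (tau alpha u) -> 0 < eps ->
  exists d, 0 < d /\ forall h, 0 <= h < d ->
    l2_norm (seq_plus (seq_minus (T h u) u) (seq_scal (RtoC h) (tau alpha u))) <= eps * h.
Proof.
  intros Hu Htu He.
  destruct (proj2 (HG u (seq_opp (tau alpha u))) (conj (conj Hu Htu) eq_refl)) as [_ [_ Hlim]].
  destruct (proj1 (vanishing_at_right (difference_error T u (seq_opp (tau alpha u)))) Hlim eps He)
    as [d [Hd H]].
  exists d. split; [assumption|]. intros h Hh.
  destruct (Req_dec h 0) as [->|Hne].
  - rewrite (sg_0 T HT) by assumption.
    replace (seq_plus _ _) with zeroseq by seq_eq. rewrite l2_norm_zero. lra.
  - assert (IT : in_l2 (T h u)) by (apply in_l2_semigroup; auto; lra).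
    specialize (H h ltac:(lra)).
    replace (seq_plus (seq_minus (T h u) u) (seq_scal (RtoC h) (tau alpha u))) with
      (seq_scal (RtoC h) (difference_error T u (seq_opp (tau alpha u)) h)).
    + rewrite l2_norm_scal by (unfold difference_error; auto 6 with l2).
      rewrite Rabs_pos_eq by lra. nra.
    + unfold difference_error. apply functional_extensionality; intro.
      unfold seq_minus, seq_plus, seq_opp, seq_scal. apply injective_projections; simpl; field; lra.
Qed.

(** A semigroup maps the domain of its generator to itself, and commutes with
    the generator there. *)
Lemma semigroup_dom t u : 0 <= t -> in_l2 u -> in_l2 (tau alpha u) ->
  in_l2 (tau alpha (T t u)) /\ tau alpha (T t u) = T t (tau alpha u).
Proof.
  intros Ht Hu Htu.
  assert (G : generator_graph T (T t u) (seq_opp (T t (tau alpha u)))).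
  { split; [auto with l2|]. split; [auto with l2|].
    apply (vanishing_at_right (difference_error T (T t u) (seq_opp (T t (tau alpha u))))).
    intros eps He. destruct (sg_bounded T HT t Ht) as [M HM].
    assert (HM0 : 0 <= Rabs M) by apply Rabs_pos. assert (HM1 := Rle_abs M).
    destruct (semigroup_increment u (eps / (Rabs M + 1) / 2) Hu Htu) as [d [Hd H]];
      [repeat apply Rdiv_lt_0_compat; lra|].
    exists d. split; [assumption|]. intros h Hh. specialize (H h ltac:(lra)).
    assert (IT : in_l2 (T h u)) by (apply in_l2_semigroup; auto; lra).
    set (z := seq_plus (seq_minus (T h u) u) (seq_scal (RtoC h) (tau alpha u))) in *.
    assert (Iz : in_l2 z) by (unfold z; auto with l2).
    replace (difference_error T (T t u) (seq_opp (T t (tau alpha u))) h)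
      with (seq_scal (RtoC (/ h)) (T t z)).
    - assert (Hi : 0 < / h) by (apply Rinv_0_lt_compat; lra).
      rewrite l2_norm_scal, Rabs_pos_eq by (auto with l2; lra).
      assert (B : l2_norm (T t z) <= (Rabs M + 1) * (eps / (Rabs M + 1) / 2 * h)).
      { eapply Rle_trans; [now apply HM|]. assert (P := l2_norm_pos z).
        apply Rle_trans with ((Rabs M + 1) * l2_norm z); [nra|].
        apply Rmult_le_compat_l; lra. }
      apply (Rmult_le_compat_l (/ h)) in B; [|lra].
      replace (/ h * ((Rabs M + 1) * (eps / (Rabs M + 1) / 2 * h))) with (eps / 2) in B by (field; lra).
      lra.
    - unfold z, difference_error.
      rewrite (sg_plus T HT), semigroup_minus, (sg_scal T HT) by auto with l2.
      rewrite <- !(sg_add T HT) by (assumption || lra). rewrite (Rplus_comm t h).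
      apply functional_extensionality; intro.
      unfold seq_minus, seq_plus, seq_opp, seq_scal. apply injective_projections; simpl; field; lra. }
  destruct (proj1 (HG _ _) G) as [[_ Htt] E]. simpl in Htt, E.
  split; [assumption|].
  replace (tau alpha (T t u)) with (seq_opp (seq_opp (tau alpha (T t u)))) by seq_eq.
  rewrite <- E. seq_eq.
Qed.

(** Left derivatives use that the operators are uniformly bounded. *)
Lemma semigroup_der_within b M u s :
  0 <= M -> (forall t w, 0 <= t <= b -> in_l2 w -> l2_norm (T t w) <= M * l2_norm w) ->
  in_l2 u -> in_l2 (tau alpha u) -> 0 <= s <= b ->
  seq_der_within 0 b (fun r => T r u) s (seq_opp (T s (tau alpha u))).
Proof.
  intros HM Hbd Hu Htu Hs eps He. set (v := tau alpha u) in *.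
  set (e := eps / (2 * M + 1)).
  assert (He' : 0 < e) by (apply Rdiv_lt_0_compat; lra).
  assert (HeM : M * e + M * e <= eps).
  { replace eps with ((2 * M + 1) * e) by (unfold e; field; lra). lra. }
  destruct (semigroup_increment u e Hu Htu He') as [d1 [Hd1 H1]]. fold v in H1.
  destruct (semigroup_tends e v Htu He') as [d2 [Hd2 H2]].
  exists (Rmin d1 d2). split; [now apply Rmin_glb_lt|].
  intros r Hr Hrs.
  assert (Hr1 := Rlt_le_trans _ _ _ Hrs (Rmin_l _ _)).
  assert (Hr2 := Rlt_le_trans _ _ _ Hrs (Rmin_r _ _)).
  assert (Pe := l2_norm_pos).
  destruct (Rle_dec s r) as [Hle|Hle].
  - set (h := r - s) in *. rewrite (Rabs_pos_eq h) in * by (unfold h; lra).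
    assert (Hh : 0 <= h) by (unfold h; lra).
    specialize (H1 h ltac:(lra)).
    assert (IT : in_l2 (T h u)) by auto with l2.
    set (z := seq_plus (seq_minus (T h u) u) (seq_scal (RtoC h) v)) in *.
    assert (Iz : in_l2 z) by (unfold z; auto with l2).
    replace (seq_minus _ _) with (T s z).
    + eapply Rle_trans; [now apply Hbd|].
      apply (Rmult_le_compat_l M) in H1; [|assumption].
      assert (0 <= M * e) by nra. nra.
    + unfold z. rewrite (sg_plus T HT), semigroup_minus, (sg_scal T HT) by (auto with l2; lra).
      rewrite <- (sg_add T HT) by (assumption || lra).
      replace (s + h) with r by (unfold h; ring). seq_eq.
  - set (h := s - r). replace (r - s) with (- h) in * by (unfold h; ring).
    rewrite Rabs_Ropp in *. assert (Hh : 0 <= h) by (unfold h; lra).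
    rewrite (Rabs_pos_eq h) in * by assumption.
    specialize (H1 h ltac:(lra)). specialize (H2 h ltac:(lra)).
    assert (IT : in_l2 (T h u)) by auto with l2.
    assert (IT2 : in_l2 (T h v)) by auto with l2.
    set (z := seq_plus (seq_minus (T h u) u) (seq_scal (RtoC h) v)) in *.
    set (y := seq_minus (T h v) v) in *.
    assert (Iz : in_l2 z) by (unfold z; auto with l2).
    assert (Iy : in_l2 y) by (unfold y; auto with l2).
    replace (seq_minus _ _) with (seq_opp (seq_plus (T r z) (seq_scal (RtoC h) (T r y)))).
    + assert (J1 : in_l2 (T r z)) by (apply in_l2_semigroup; auto; lra).
      assert (J2 : in_l2 (T r y)) by (apply in_l2_semigroup; auto; lra).
      rewrite l2_norm_opp by auto with l2.
      eapply Rle_trans; [apply l2_norm_plus; auto with l2|].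
      rewrite l2_norm_scal, Rabs_pos_eq by assumption.
      assert (B1 := Hbd r z ltac:(lra) Iz). assert (B2 := Hbd r y ltac:(lra) Iy).
      apply (Rmult_le_compat_l M) in H1; [|assumption].
      assert (B3 : M * l2_norm y <= M * e) by (apply Rmult_le_compat_l; lra).
      assert (B4 : h * l2_norm (T r y) <= h * (M * e)) by (apply Rmult_le_compat_l; lra).
      nra.
    + unfold z, y.
      rewrite (sg_plus T HT), !semigroup_minus, (sg_scal T HT) by (auto with l2; lra).
      rewrite <- !(sg_add T HT) by (assumption || lra).
      replace (r + h) with s by (unfold h; ring). seq_eq.
Qed.

Lemma eq_of_norm_small (u v : cseq) : in_l2 u -> in_l2 v ->
  (forall eps, 0 < eps -> l2_norm (seq_minus u v) <= eps) -> u = v.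
Proof.
  intros Hu Hv H. apply functional_extensionality. intros n.
  assert (E : (u n - v n)%C = RtoC 0).
  { apply Cmod_eq_0. apply Rle_antisym; [|apply Cmod_ge_0].
    apply le_epsilon. intros eps He. rewrite Rplus_0_l.
    eapply Rle_trans; [apply (coord_le_norm (seq_minus u v) n); auto with l2|auto]. }
  replace (u n) with ((u n - v n) + v n)%C by ring. rewrite E. ring.
Qed.

(** Orbits in the domain solve the heat equation as long as the operators are
    uniformly bounded, hence follow the flow; density extends this to l^2, and
    the semigroup law to all times. *)
Lemma semigroup_is_flow t u : 0 <= t -> in_l2 u -> T t u = flow alpha t u.
Proof.
  destruct semigroup_locally_bounded as [d [M [Hd [HM Hbd]]]].
  assert (Hsmall : forall t u, 0 <= t <= d -> in_l2 u -> T t u = flow alpha t u).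
  { clear t u. intros t u Ht Hu.
    assert (Hdom : forall w, in_l2 w -> in_l2 (tau alpha w) -> T t w = flow alpha t w).
    { intros w Hw Htw.
      rewrite (heat_equation_unique alpha Ha 0 t (fun r => T r w)); [|lra..|].
      - now rewrite Rminus_0_r, (sg_0 T HT).
      - intros r Hr. destruct (semigroup_dom r w ltac:(lra) Hw Htw) as [I E].
        split; [apply in_l2_semigroup; auto; lra|]. split; [assumption|].
        rewrite E. apply (semigroup_der_within t M); auto. intros q z Hq. apply Hbd. lra. }
    assert (IT : in_l2 (T t u)) by (apply in_l2_semigroup; auto; lra).
    assert (IS : in_l2 (flow alpha t u)) by (apply in_l2_flow; auto; lra).
    apply eq_of_norm_small; auto. intros eps He.
    destruct (trunc_dense u (eps / (M + 1)) Hu) as [N HN]; [apply Rdiv_lt_0_compat; lra|].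
    destruct (regular_trunc alpha Ha N u) as [Iv Itv _ _].
    set (v := trunc N u) in *. set (z := seq_minus u v) in *.
    assert (Iz : in_l2 z) by (unfold z; auto with l2).
    replace (seq_minus (T t u) (flow alpha t u)) with (seq_minus (T t z) (flow alpha t z)).
    - assert (J1 : in_l2 (T t z)) by (apply in_l2_semigroup; auto; lra).
      assert (J2 : in_l2 (flow alpha t z)) by (apply in_l2_flow; auto; lra).
      eapply Rle_trans; [apply l2_norm_minus; auto|].
      assert (B1 := Hbd t z Ht Iz). assert (B2 := proj2 (flow_contraction alpha Ha t z (proj1 Ht) Iz)).
      apply (Rmult_le_compat_l (M + 1)) in HN; [|lra].
      replace ((M + 1) * (eps / (M + 1))) with eps in HN by (field; lra). lra.
    - unfold z. rewrite semigroup_minus, flow_minus, (Hdom v) by (auto; lra). seq_eq. }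
  assert (Hn : forall n t, 0 <= t <= INR n * d -> forall u, in_l2 u -> T t u = flow alpha t u).
  { induction n as [|n IH]; intros s Hs w Hw.
    - apply Hsmall; [simpl in Hs; lra|assumption].
    - destruct (Rle_dec s d) as [H|H]; [apply Hsmall; [lra|assumption]|].
      rewrite S_INR in Hs. replace s with (d + (s - d)) by ring.
      rewrite (sg_add T HT), flow_add by (assumption || lra).
      rewrite (IH (s - d)) by (assumption || lra).
      apply Hsmall; [lra|]. apply in_l2_flow; auto; lra. }
  intros Ht Hu. destruct (INR_unbounded (t / d)) as [n Hn'].
  apply (Hn n); [|assumption]. split; [assumption|]. left.
  apply (Rmult_lt_compat_r d) in Hn'; [|assumption].
  replace (t / d * d) with t in Hn' by (field; lra). assumption.
Qed.
End UniqueGeneration.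

(** * Positivity and the maximum principle *)

Lemma flow_positive alpha t u : -1 < alpha -> 0 <= t -> in_l2 u ->
  seq_nonneg u -> seq_nonneg (flow alpha t u).
Proof.
  intros Ha Ht Hu Hpos n. unfold flow. simpl. split.
  - transitivity (Series (fun m => 0 * 0)); [|rewrite Series_scal_l; ring].
    apply Series_ext. intros m. destruct (Hpos m) as [E _].
    unfold hrow, dot. rewrite E. simpl. ring.
  - assert (Hm : forall m, 0 <= dot (u m) (hrow alpha (RtoC 1) t n m)).
    { intros m. destruct (Hpos m) as [_ H]. assert (Hh := heat_nonneg alpha t n m Ha Ht).
      unfold hrow, dot. simpl. unfold Re, Im in *. nra. }
    eapply Rle_trans; [|apply (sum_le_Series _ 0 Hm)].
    + rewrite sum_O. apply Hm.
    + apply ex_dot; [assumption|now apply in_l2_hrow].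
Qed.

Lemma wgt_alpha_0 k : wgt 0 k = 1.
Proof.
  induction k as [|k IH]; [reflexivity|]. simpl. rewrite IH.
  assert (H := pos_INR k). field. lra.
Qed.

(** The modulus of an entry [z] is controlled by testing against [z] itself,
    which reduces the complex bound to the real row sums. *)
Lemma flow_bounded t u M : 0 <= t -> in_l2 u -> (forall n, Cmod (u n) <= M) ->
  forall n, Cmod (flow 0 t u n) <= M.
Proof.
  intros Ht Hu HM n.
  assert (HM0 : 0 <= M) by (eapply Rle_trans; [apply Cmod_ge_0|apply (HM 0%nat)]).
  set (z := flow 0 t u n).
  assert (B : Cmod z ^ 2 <= M * Cmod z).
  { rewrite Cmod_sq. unfold z at 1. rewrite dot_flow by (assumption || lra).
    apply Series_le_bound; [apply ex_dot; [assumption|apply in_l2_hrow; lra]|]. intros N.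
    apply Rle_trans with (sum_n (fun m => (M * Cmod z) * (heat 0 t n m * sqrt (wgt 0 m))) N).
    - apply sum_le. intros m _. rewrite wgt_alpha_0, sqrt_1, Rmult_1_r.
      assert (Hh := heat_nonneg 0 t n m ltac:(lra) Ht).
      assert (E : dot (u m) (hrow 0 z t n m) = heat 0 t n m * dot (u m) z).
      { unfold hrow, dot. simpl. unfold Re, Im. ring. }
      rewrite E. rewrite (Rmult_comm (M * Cmod z)). apply Rmult_le_compat_l; [assumption|].
      eapply Rle_trans; [apply Rle_abs|]. eapply Rle_trans; [apply dot_le|].
      apply Rmult_le_compat_r; [apply Cmod_ge_0|apply HM].
    - rewrite sum_scal. assert (H := heat_row_sum 0 t n N ltac:(lra) Ht).
      rewrite wgt_alpha_0, sqrt_1 in H. assert (H0 := Cmod_ge_0 z). assert (0 <= M * Cmod z) by nra.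
      rewrite <- (Rmult_1_r (M * Cmod z)) at 2. now apply Rmult_le_compat_l. }
  assert (H0 := Cmod_ge_0 z). destruct (Req_dec (Cmod z) 0) as [E|E]; [lra|]. nra.
Qed.

Lemma linf_norm_le u v : (forall M, (forall n, Cmod (u n) <= M) -> forall n, Cmod (v n) <= M) ->
  in_linf u -> Rbar_le (linf_norm v) (linf_norm u).
Proof.
  intros H [B HB].
  destruct (is_sup_seq_lub _ _ (Sup_seq_correct (fun n => Finite (Cmod (u n))))) as [Hub Hleast].
  destruct (is_sup_seq_lub _ _ (Sup_seq_correct (fun n => Finite (Cmod (v n))))) as [_ Hlv].
  fold (linf_norm u) in *. fold (linf_norm v) in *.
  apply Hlv. intros x [n ->].
  destruct (linf_norm u) as [M| |].
  - apply (H M). intros k. apply (Hub (Finite (Cmod (u k)))). now exists k.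
  - exact I.
  - exact (Hub (Finite (Cmod (u 0%nat))) (ex_intro _ 0%nat eq_refl)).
Qed.

Theorem corollary3p3 (alpha : R) (halpha : -1 < alpha) :
  (exists T : R -> cseq -> cseq, generates (laguerre alpha) T) /\
  (forall T : R -> cseq -> cseq, generates (laguerre alpha) T ->
     positivity_preserving T /\ (alpha = 0 -> markovian T)).
Proof.
  split.
  - exists (flow alpha). now apply flow_generates.
  - intros T [HT HG].
    assert (E := semigroup_is_flow T HT alpha halpha HG).
    assert (Hp : positivity_preserving T).
    { intros t u Ht Hu Hpos. rewrite E by (assumption || lra). apply flow_positive; auto; lra. }
    split; [exact Hp|]. intros ->. split; [exact Hp|].
    intros t u Ht Hu Hinf. rewrite E by (assumption || lra).
    apply linf_norm_le; [|assumption]. intros M HM. apply flow_bounded; auto; lra.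
Qed.
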